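(* Let $X$ be a locally compact Hausdorff connected space. Let $TM_c(X)$ be the set of compact-finite topological measures on $X$, $\mathbf{TM}(X)$ the set of finite topological measures on $X$, $QI_c(X)$ the set of quasi-linear functionals on $C_c(X)$, and $\mathbf{QI_0}(X)$ the set of quasi-linear functionals $\rho$ on $C_0(X)$ with $\|\rho\|<\infty$. Let $\mathbf{QI}$ be either $\mathbf{QI_0}(X)$ or the set of $\rho\in QI_c(X)$ with $\|\rho\|<\infty$. (I) The map $\Pi:TM_c(X)\to QI_c(X)$, $\Pi(\mu)=\rho_\mu$, is an order-preserving bijection with inverse $\Pi^{-1}(\rho)=\mu_\rho$, and $\mu$ is a measure if and only if $\Pi(\mu)$ is a linear functional. (II) The map $\Pi:\mathbf{TM}(X)\to\mathbf{QI}$, $\Pi(\mu)=\rho_\mu$ (with $\rho_\mu$ regarded as a functional on $C_0(X)$ or $C_c(X)$ according to the choice of $\mathbf{QI}$), with $\Pi^{-1}(\rho)=\mu_\rho$, is an order-preserving bijection such that $\|\rho\|=\|\mu\|$ whenever $\rho=\Pi(\mu)$, where $\|\mu\|=\mu(X)$.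
   Context: $C_0(X)$, $C_c(X)$, $C_b(X)$ are the real-valued continuous functions on $X$ vanishing at infinity, with compact support, and bounded, respectively, with the uniform norm (all equal to $C(X)$ if $X$ is compact); $\operatorname{supp} f=\overline{\{f\neq0\}}$. Singly generated subalgebra: for $f\in C_b(X)$, $S(f)$ is the smallest uniformly closed subalgebra of $C_b(X)$ containing $f$ and, if $X$ is compact, also containing the constant $1$. (If $X$ is compact, $S(f)=\{\phi\circ f:\phi\in C(f(X))\}$; if $X$ is not compact and $f\in C_0(X)$ or $C_c(X)$, $S(f)=\{\phi\circ f:\phi\in C(\overline{f(X)}),\ \phi(0)=0\}$, which lies in $C_0(X)$, resp. $C_c(X)$.) Quasi-linear functional on $\mathcal B$ ($\mathcal B=C_0(X)$ or $C_c(X)$): a map $\rho:\mathcal B\to\mathbb R$ with $\rho(af)=a\rho(f)$ for $a\in\mathbb R$, $f\in\mathcal B$; $\rho(f+g)=\rho(f)+\rho(g)$ whenever $f,g\in S(h)$ for some $h\in\mathcal B$; and $\rho(f)\ge0$ whenever $f\ge0$. Its norm is $\|\rho\|=\sup\{\rho(f): f\in\mathcal B,\ 0\le f\le1\}\in[0,\infty]$. Topological measure on $X$: a set function $\mu$ from the open and closed subsets of $X$ to $[0,\infty]$, not identically $\infty$, such that (TM1) $\mu(A\sqcup B)=\mu(A)+\mu(B)$ whenever $A,B$ are disjoint and each of $A,B,A\sqcup B$ is compact or open; (TM2) $\mu(U)=\sup\{\mu(K):K\subseteq U \text{ compact}\}$ for $U$ open; (TM3) $\mu(F)=\inf\{\mu(U):U\supseteq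 F\text{ open}\}$ for $F$ closed. It is finite if $\mu(X)<\infty$, and compact-finite if $\mu(K)<\infty$ for all compact $K$. ''$\mu$ is a measure'' means that $\mu$ is the restriction to the open and closed sets of a Borel measure on $X$ that is inner regular (by compact sets) on open sets and outer regular. Functional $\rho_\mu$: it is defined on $C_0(X)$ if $\mu$ is finite (case (A)), and on $C_c(X)$ if $\mu$ is compact-finite (case (B)), by $\rho_\mu(f)=\int_{\mathbb R}t\,dm_f(t)$, where $m_f$ is the Stieltjes measure on $\mathbb R$ with $m_f((s,t])=F(s)-F(t)$ for $s<t$, and $F(a)=\mu(f^{-1}((a,\infty)))$ in case (A), $F(a)=\mu(f^{-1}((a,\infty)\setminus\{0\}))$ in case (B). (If both cases apply to $f$ they give the same value.) Set function $\mu_\rho$: $\mu_\rho(U)=\sup\{\rho(f): f\in C_c(X),\ 0\le f\le1,\ \operatorname{supp} f\subseteq U\}$ for $U$ open, and $\mu_\rho(F)=\inf\{\mu_\rho(U):F\subseteq U,\ U\text{ open}\}$ for $F$ closed. Orders: $\mu\le\nu$ for topological measures means $\mu(A)\le\nu(A)$ for all open or closed $A$; $\rho\le\eta$ for quasi-linear functionals means $\rho(f)\le\eta(f)$ for all $f\ge0$ in the domain. Order-preserving means $\mu\le\nu$ implies $\Pi(\mu)\le\Pi(\nu)$. *)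

(* Defs.v *)
From HB Require Import structures.
From mathcomp Require Import all_boot all_order all_algebra.
From mathcomp Require Import all_classical all_reals all_analysis.

Set Implicit Arguments.
Unset Strict Implicit.
Unset Printing Implicit Defensive.

Import Order.TTheory GRing.Theory Num.Theory.
Import numFieldNormedType.Exports.

Local Open Scope classical_set_scope.
Local Open Scope ring_scope.

Section function_spaces.
Context (R : realType) (X : topologicalType).
Implicit Types f g : X -> R.

Definition supp f : set X := closure [set x | f x != 0].

Definition C_b : set (X -> R) := [set f | continuous f /\ bounded_fun f].

Definition C_0_pred : {pred X -> R} :=
  [pred f | `[< continuous f /\
                forall e : R, 0 < e -> compact [set x | e <= `|f x|] >]].

Definition C_c_pred : {pred X -> R} :=
  [pred f | `[< continuous f /\ compact (supp f) >]].

Lemma continuous_lincomb (a : R) f g :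
  continuous f -> continuous g -> continuous (a *: f + g).
Proof.
move=> cf cg x; apply: continuousD; last exact: cg.
by apply: continuousM; [exact: cst_continuous|exact: cf].
Qed.

Lemma C_0_submod_closed : submod_closed C_0_pred.
Proof.
split=> [|a f g /asboolP[cf f0] /asboolP[cg g0]]; apply/asboolP; split.
- exact: (@cst_continuous _ _ 0).
- move=> e e0; rewrite [X in compact X](_ : _ = set0); first exact: compact0.
  by apply/seteqP; split=> // x /=; rewrite normr0 leNgt e0.
- exact: continuous_lincomb.
- move=> e e0.
  have a1 : 0 < `|a| + 1 by rewrite ltr_wpDl.
  have /f0 K1 : 0 < e / 2 / (`|a| + 1) by rewrite !divr_gt0.
  have /g0 K2 : 0 < e / 2 by rewrite divr_gt0.
  apply: (subclosed_compact _ (compactU K1 K2)).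
    have ch : continuous (fun x => `|(a *: f + g) x|).
      move=> x; apply: (@continuous_comp _ _ _ (a *: f + g) Num.norm).
        exact: continuous_lincomb.
      exact: norm_continuous.
    exact: (closed_comp (fun x _ => ch x) (@closed_ge _ e)).
  move=> x /= ex; apply: contrapT => /not_orP[/negP + /negP].
  rewrite -!ltNge ltr_pdivlMr// => fx gx; move: ex; apply/negP; rewrite -ltNge.
  rewrite (le_lt_trans (ler_normD _ _))// [ltRHS](splitr e) ler_ltD//.
  by rewrite normrM (le_trans _ (ltW fx))// mulrC ler_wpM2l// lerDl//.
Qed.

Lemma C_c_submod_closed : submod_closed C_c_pred.
Proof.
split=> [|a f g /asboolP[cf f0] /asboolP[cg g0]]; apply/asboolP; split.
- exact: (@cst_continuous _ _ 0).
- rewrite /supp [X in closure X](_ : _ = set0) ?closure0; first exact: compact0.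
  by apply/seteqP; split=> // x /=; rewrite eqxx.
- exact: continuous_lincomb.
- apply: (subclosed_compact _ (compactU f0 g0)); first exact: closed_closure.
  rewrite -closureU; apply: closureS => x /= afg0.
  apply: contrapT => /not_orP[/negP + /negP].
  rewrite !negbK => /eqP fx /eqP gx; move: afg0.
  have -> : (a *: f + g) x = a * f x + g x by [].
  by rewrite fx gx mulr0 addr0 eqxx.
Qed.

HB.instance Definition _ :=
  GRing.isSubmodClosed.Build _ _ C_0_pred C_0_submod_closed.
HB.instance Definition _ :=
  GRing.isSubmodClosed.Build _ _ C_c_pred C_c_submod_closed.

Definition C_0 : Type := {f : X -> R | f \in C_0_pred}.
Definition C_c : Type := {f : X -> R | f \in C_c_pred}.

HB.instance Definition _ := SubChoice.on C_0.
HB.instance Definition _ := [SubChoice_isSubLmodule of C_0 by <:].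
HB.instance Definition _ := SubChoice.on C_c.
HB.instance Definition _ := [SubChoice_isSubLmodule of C_c by <:].

Lemma C_0_continuous (f : C_0) : continuous (\val f).
Proof. by case: f => f /= /asboolP[]. Qed.

Lemma C_c_continuous (f : C_c) : continuous (\val f).
Proof. by case: f => f /= /asboolP[]. Qed.

(* A uniform limit of bounded continuous functions is one, so a part of
   [C_b] is closed in [C_b] iff it is closed in [{uniform X -> R}]. *)
Definition closed_subalgebra (A : set (X -> R)) : Prop :=
  [/\ A `<=` C_b, A (cst 0),
      forall a f g, A f -> A g -> A (a *: f + g),
      forall f g, A f -> A g -> A (f \* g) &
      closed (A : set {uniform X -> R})].

Definition singly_generated f : set (X -> R) :=
  smallest [set A | closed_subalgebra A /\ (compact [set: X] -> A (cst 1))]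
           [set f].

End function_spaces.
Arguments C_0 : clear implicits.
Arguments C_c : clear implicits.
Arguments C_b {R X}.
Arguments C_c_pred {R X}.
Arguments C_0_continuous {R X} f.
Arguments C_c_continuous {R X} f.

Section quasi_linear.
Context (R : realType) (X : topologicalType).
Context (P : {pred X -> R}) (B : subLmodType P).
Implicit Types (rho : B -> R) (f g h : B).

Definition quasi_linear rho : Prop :=
  [/\ forall a f, rho (a *: f) = a * rho f,
      forall f g, (exists h, singly_generated (\val h) (\val f) /\
                             singly_generated (\val h) (\val g)) ->
        rho (f + g) = rho f + rho g &
      forall f, (forall x, 0 <= \val f x) -> 0 <= rho f].

Definition qnorm rho : \bar R :=
  ereal_sup [set (rho f)%:E | f in [set f : B | forall x, 0 <= \val f x <= 1]].

Definition le_functional rho1 rho2 : Prop :=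
  forall f, (forall x, 0 <= \val f x) -> rho1 f <= rho2 f.

End quasi_linear.

Record open_or_closed (X : topologicalType) := OpenOrClosed {
  ocset :> set X ;
  ocsetP : open ocset \/ closed ocset }.

Definition oc_open (X : topologicalType) (U : set X) (oU : open U) :
  open_or_closed X := OpenOrClosed (or_introl oU).

Section topological_measures.
Context (R : realType) (X : topologicalType).
Local Open Scope ereal_scope.
Implicit Types mu nu : open_or_closed X -> \bar R.

Definition topological_measure mu : Prop :=
  [/\ forall A, 0 <= mu A,
      exists A, mu A != +oo,
      forall A B C : open_or_closed X,
        A `&` B = set0 -> C = A `|` B :> set X ->
        compact A \/ open A -> compact B \/ open B -> compact C \/ open C ->
        mu C = mu A + mu B,
      forall U : open_or_closed X, open U ->
        mu U = ereal_sup
          [set mu K | K in [set K : open_or_closed X | compact K /\ K `<=` U]] &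
      forall F : open_or_closed X, closed F ->
        mu F = ereal_inf
          [set mu U | U in [set U : open_or_closed X | open U /\ F `<=` U]]].

Definition total_mass mu : \bar R := mu (oc_open (@openT X)).

Definition finite_tm mu : Prop := total_mass mu < +oo.

Definition compact_finite_tm mu : Prop :=
  forall K : open_or_closed X, compact K -> mu K < +oo.

Definition le_tm mu nu : Prop := forall A, mu A <= nu A.

End topological_measures.

(* [measurableType] requires a base point, which a [topologicalType] need not
   have; [pointed_at x0] is [X] with base point [x0]. *)
Definition pointed_at (X : topologicalType) (x0 : X) : Type := X.
HB.instance Definition _ (X : topologicalType) (x0 : X) :=
  Choice.on (pointed_at x0).
HB.instance Definition _ (X : topologicalType) (x0 : X) :=
  isPointed.Build (pointed_at x0) x0.

Definition borel (X : topologicalType) (x0 : X) :=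
  g_sigma_algebraType (open : set (set (pointed_at x0))).

(* The choice of base point is immaterial; quantifying over it universally makes
   the (zero) topological measure on the empty space a measure, as it should. *)
Definition is_measure (R : realType) (X : topologicalType)
    (mu : open_or_closed X -> \bar R) : Prop :=
  forall x0 : X, exists m : {measure set (borel x0) -> \bar R},
    [/\ forall A, mu A = m A,
        forall U : set X, open U ->
          m U = ereal_sup
            [set m K | K in [set K : set X | compact K /\ K `<=` U]] &
        forall E : set (borel x0), measurable E ->
          m E = ereal_inf
            [set m U | U in [set U : set X | open U /\ E `<=` U]]].

Section stieltjes.
Context (R : realType).
Implicit Types G F : R -> R.

Definition is_cumulative G : Prop :=
  {homo G : x y / x <= y} /\ right_continuous G.

Definition Cumulative_of G (cG : is_cumulative G) : cumulative R R :=
  HB.pack G (isCumulative.Build R _ R G cG.1 cG.2).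

(* The fallback [idfun] is never used: see [stieltjes_tail_0] and
   [stieltjes_tail_c] below. *)
Definition cumulative_of G : cumulative R R :=
  if pselect (is_cumulative G) is left cG then Cumulative_of cG else idfun.

(* [F] is nonincreasing; see [stieltjes_itv] for the sign convention. *)
Definition stieltjes F : {measure set (measurableTypeR R) -> \bar R} :=
  lebesgue_stieltjes_measure (cumulative_of (\- F)).

Lemma stieltjes_itv F (s t : R) : is_cumulative (\- F) -> s < t ->
  stieltjes F `]s, t]%classic = (F s - F t)%:E.
Proof.
move=> cF st.
rewrite /stieltjes/= /lebesgue_stieltjes_measure /measure_extension.
rewrite measurable_mu_extE/=; last exact: is_ocitv.
rewrite wlength_itv_bnd ?ltW// /cumulative_of; case: pselect => // cF'.
by rewrite /= opprK addrC.
Qed.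

End stieltjes.

Section correspondence.
Context (R : realType) (X : topologicalType).
Implicit Types mu : open_or_closed X -> \bar R.

Lemma open_gt (f : X -> R) (a : R) : continuous f -> open (f @^-1` `]a, +oo[).
Proof. by move=> cf; apply: open_comp => // x _; exact: cf. Qed.

Lemma open_gt_neq0 (f : X -> R) (a : R) :
  continuous f -> open (f @^-1` (`]a, +oo[ `\ 0)).
Proof.
move=> cf; apply: open_comp => [x _|]; first exact: cf.
by rewrite setDE; apply: openI => //; apply: closed_openC; exact: closed_eq.
Qed.

Lemma tm_compact_le_open mu (K U : open_or_closed X) :
  topological_measure mu -> compact K -> open U -> K `<=` U -> (mu K <= mu U)%E.
Proof.
move=> [_ _ _ tm2 _] cK oU KU; rewrite (tm2 U)//.
by apply: ereal_sup_ubound; exists K.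
Qed.

Lemma tm_open_le mu (U W : open_or_closed X) :
  topological_measure mu -> open U -> open W -> U `<=` W -> (mu U <= mu W)%E.
Proof.
move=> [_ _ _ tm2 _] oU oW UW; rewrite (tm2 U)// (tm2 W)//.
apply: ereal_sup_le => _ [K [cK KU] <-]; exists K => //; split=> //.
exact: subset_trans UW.
Qed.

Lemma tm_open_le_closed mu (U F : open_or_closed X) :
  topological_measure mu -> open U -> closed F -> U `<=` F -> (mu U <= mu F)%E.
Proof.
move=> tm oU cF UF; case: (tm) => _ _ _ _ tm3; rewrite (tm3 F)//.
apply: le_ereal_inf_tmp => _ [W [oW FW] <-].
by apply: tm_open_le => //; exact: subset_trans FW.
Qed.

Lemma cumulative_tail mu (V : R -> open_or_closed X) :
  topological_measure mu ->
  (forall a, open (V a)) -> (forall a, mu (V a) < +oo)%E ->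
  (forall a, V a = \bigcup_(b in [set b | a < b]) V b :> set X) ->
  is_cumulative (\- (fun a => fine (mu (V a)))).
Proof.
move=> tm oV Voo VE.
have V_ge0 A : (0 <= mu A)%E by case: tm.
have Vfin a : mu (V a) \is a fin_num by rewrite ge0_fin_numE.
have VS a b : a <= b -> V b `<=` V a.
  move=> ab; rewrite (VE a) (VE b) => x [c /= bc Vx]; exists c => //=.
  exact: le_lt_trans bc.
have muV a b : a <= b -> fine (mu (V b)) <= fine (mu (V a)).
  by move=> ab; rewrite fine_le//; apply: tm_open_le => //; exact: VS.
split=> [a b ab|a]; first by rewrite lerN2 muV.
apply: cvgN; apply/cvgrPdist_lt => e e0.
have [K [cK KV] Ke] : exists2 K : open_or_closed X, compact K /\ K `<=` V a &
    (mu (V a) - e%:E < mu K)%E.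
  have : (mu (V a) - e%:E < mu (V a))%E.
    by rewrite -(fineK (Vfin a)) -EFinB lte_fin ltrBlDr ltrDl.
  case: (tm) => _ _ _ tm2 _; rewrite [ltRHS]tm2// => /ereal_sup_gt[_ [K ? <-] ?].
  by exists K.
have KVnear : \forall b \near a^'+, K `<=` V b.
  move: cK => /compact_near_coveringP; apply=> x /KV.
  rewrite VE => -[c /= ac Vcx].
  exists (V c : set X, [set b | b <= c]) => /=.
    by split; [exact: open_nbhs_nbhs|exact: nbhs_right_le].
  by move=> [y b] /= [Vcy bc]; exact: VS Vcy.
near=> x.
have ax : a < x by near: x; exact: nbhs_right_gt.
have KVx : K `<=` V x by near: x.
rewrite ger0_norm ?subr_ge0 ?muV ?ltW// ltrBlDr -ltrBlDl.
rewrite -lte_fin EFinB !fineK// (lt_le_trans Ke)//.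
exact: tm_compact_le_open.
Unshelve. all: by end_near. Qed.

(* [fine] loses nothing here: a finite [mu] is finite on every open set, and a
   compact-finite [mu] is finite on the open subsets of [supp f]. *)
Definition tail_0 mu (f : C_0 R X) (a : R) : R :=
  fine (mu (oc_open (open_gt a (C_0_continuous f)))).

Definition tail_c mu (f : C_c R X) (a : R) : R :=
  fine (mu (oc_open (open_gt_neq0 a (C_c_continuous f)))).

Definition rho_0 mu (f : C_0 R X) : R :=
  \int[stieltjes (tail_0 mu f)]_(t in [set: R]) t.

Definition rho_c mu (f : C_c R X) : R :=
  \int[stieltjes (tail_c mu f)]_(t in [set: R]) t.

Lemma stieltjes_tail_0 mu (f : C_0 R X) (s t : R) :
  topological_measure mu -> finite_tm mu -> s < t ->
  stieltjes (tail_0 mu f) `]s, t]%classic = (tail_0 mu f s - tail_0 mu f t)%:E.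
Proof.
move=> tm muoo; apply: stieltjes_itv; apply: cumulative_tail => // [a|a|a].
- exact/open_gt/C_0_continuous.
- apply: le_lt_trans muoo; apply: tm_open_le => //; last exact: openT.
  exact/open_gt/C_0_continuous.
- apply/seteqP; split=> [x|x [b /= ab]] /=; rewrite !in_itv/= !andbT; last first.
    exact: lt_trans.
  move=> afx; exists ((a + \val f x) / 2) => /=; first by rewrite midf_lt.
  by rewrite in_itv/= andbT midf_lt.
Qed.

Lemma stieltjes_tail_c mu (f : C_c R X) (s t : R) :
  topological_measure mu -> compact_finite_tm mu -> s < t ->
  stieltjes (tail_c mu f) `]s, t]%classic = (tail_c mu f s - tail_c mu f t)%:E.
Proof.
move=> tm muoo; apply: stieltjes_itv; apply: cumulative_tail => // [a|a|a].
- exact/open_gt_neq0/C_c_continuous.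
- pose F := OpenOrClosed (or_intror (@closed_closure _ [set x | \val f x != 0])).
  apply: (@le_lt_trans _ _ (mu F)).
    apply: tm_open_le_closed => //; first exact/open_gt_neq0/C_c_continuous.
      exact: closed_closure.
    by move=> x [_ /eqP fx]; exact: subset_closure.
  by apply: muoo; have /asboolP[] := valP f.
- apply/seteqP; split=> [x|x [b /= ab]] /=; rewrite !in_itv/= !andbT; last first.
    by move=> [bfx f0]; split=> //; exact: lt_trans bfx.
  move=> [afx f0]; exists ((a + \val f x) / 2) => /=; first by rewrite midf_lt.
  by rewrite in_itv/= andbT midf_lt.
Qed.

End correspondence.

Section set_function_of_functional.
Context (R : realType) (X : topologicalType).
Context (P : {pred X -> R}) (B : subLmodType P).
Local Open Scope ereal_scope.
Implicit Types rho : B -> R.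

Definition mu_open rho (U : set X) : \bar R :=
  ereal_sup [set (rho f)%:E | f in [set f : B |
    [/\ \val f \in C_c_pred, forall x, (0 <= \val f x <= 1)%R &
        supp (\val f) `<=` U]]].

Definition mu_of rho (A : open_or_closed X) : \bar R :=
  if `[< open A >] then mu_open rho A
  else ereal_inf [set mu_open rho U | U in [set U | open U /\ A `<=` U]].

End set_function_of_functional.

Section spaces.
Context (R : realType) (X : topologicalType).
Local Open Scope ereal_scope.

Definition TM_c : set (open_or_closed X -> \bar R) :=
  [set mu | topological_measure mu /\ compact_finite_tm mu].

Definition TM_fin : set (open_or_closed X -> \bar R) :=
  [set mu | topological_measure mu /\ finite_tm mu].

Definition QI_c : set (C_c R X -> R) := [set rho | quasi_linear rho].

Definition QI_c_fin : set (C_c R X -> R) :=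
  [set rho | quasi_linear rho /\ qnorm rho < +oo].

Definition QI_0_fin : set (C_0 R X -> R) :=
  [set rho | quasi_linear rho /\ qnorm rho < +oo].

End spaces.
Arguments TM_c : clear implicits.
Arguments TM_fin : clear implicits.
Arguments QI_c : clear implicits.
Arguments QI_c_fin : clear implicits.
Arguments QI_0_fin : clear implicits.

(* Main.v *)
Require Import Defs.
From HB Require Import structures.
From mathcomp Require Import all_boot all_order all_algebra.
From mathcomp Require Import all_classical all_reals all_analysis.
From mathcomp Require Import measurable_realfun.
From mathcomp Require Import ring lra.

(* A quasi-linear functional is additive on the functions cut out of a single
   one, so it splits along the layers [min (max (f - c) 0) e] of [f].  A layer
   of [f <= g] lies below a layer of [g] that is constant on its support, and
   such a pair lives in one [S(h)]; hence monotonicity.  The same layers, now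
   compared through the values of [mu_rho] on the sets [{f > c}], show that
   [mu_rho] determines [rho] and does so monotonically.
   Conversely the tail of [f] under [mu] defines a measure on the line with
   [nu W = mu (f^-1 W)] for every open [W] not containing [0].  If
   [g = phi o f], the image of this measure by [phi] plays the same role for
   [g], so [rho_mu g] is the integral of [phi] for [nu]: on [S(f)], [rho_mu] is
   an honest integral.  Test functions squeezed between a compact set and an
   open one give [mu_(rho_mu) = mu], whence [rho_(mu_rho) = rho] by the
   injectivity of [rho |-> mu_rho].  When [rho] is linear, [mu_rho] extends to
   an outer measure for which open sets are Caratheodory measurable. *)

Import Order.TTheory GRing.Theory Num.Theory.
Import numFieldNormedType.Exports.

Local Open Scope classical_set_scope.
Local Open Scope ring_scope.

(** * Urysohn functions *)

(** Two facts about [singly_generated h] carry everything: it contains [h] and each positive part of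
    [h - c] with [c >= 0], and its members are constant on the fibres of [h] and, on a noncompact
    space, vanish where [h] does. The first feeds the functional side, the second the measure side.
    There the factor [phi] in [f = phi o h] is only shown to be Borel, so the preimage of an open
    set by [phi] need not be open; what saves the argument is that the measure lives on the range of
    [h] with 0 added, and that this set is closed. The fibre over 0 need not be compact and may have
    infinite mass, so measures are compared away from 0, which the integrand [t] permits. Layer
    comparisons always lose a slice at the bottom of [f]. Since no continuity of the functional is
    assumed, the slice is discarded by a separate estimate, linear in its height, which comes from a
    cut-off function on [C_c] and from the finite norm on [C_0]. Monotonicity rests on that
    estimate, which therefore may not use it. *)

Section continuity.
Context {R : realType} {X : topologicalType}.
Implicit Types f g : X -> R.

Lemma continuous_maxf f g : continuous f -> continuous g ->
  continuous (fun x => Num.max (f x) (g x)).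
Proof. by move=> cf cg x; exact: (continuous_max (cf x) (cg x)). Qed.

Lemma continuous_minf f g : continuous f -> continuous g ->
  continuous (fun x => Num.min (f x) (g x)).
Proof. by move=> cf cg x; exact: (continuous_min (cf x) (cg x)). Qed.

Lemma continuous_addf f g : continuous f -> continuous g ->
  continuous (fun x => f x + g x).
Proof. by move=> cf cg x; exact: (continuousD (cf x) (cg x)). Qed.

Lemma continuous_subf f g : continuous f -> continuous g ->
  continuous (fun x => f x - g x).
Proof. by move=> cf cg x; exact: (continuousB (cf x) (cg x)). Qed.

Lemma continuous_mulf f g : continuous f -> continuous g ->
  continuous (fun x => f x * g x).
Proof. by move=> cf cg x; exact: (continuousM (cf x) (cg x)). Qed.

Lemma continuous_cstf (c : R) : continuous (fun _ : X => c).
Proof. exact: cst_continuous. Qed.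

Lemma closed_supp f : closed (supp f).
Proof. exact: closed_closure. Qed.

Lemma supp_neq0 f x : f x != 0 -> supp f x.
Proof. by move=> fx; apply: (@subset_closure _ [set x | f x != 0]). Qed.

Lemma supp_eq0 f x : ~ supp f x -> f x = 0.
Proof. by move=> nfx; apply: contrapT => /eqP/supp_neq0. Qed.

Lemma supp_sub f (F : set X) :
  closed F -> (forall x, f x != 0 -> F x) -> supp f `<=` F.
Proof. by move=> cF fF; rewrite (closure_id F).1//; exact: closureS. Qed.

Lemma open_preim_lt f (a : R) : continuous f -> open [set x | a < f x].
Proof.
move=> cf; have := @open_comp _ _ f [set t | a < t] (fun x _ => cf x).
by apply; exact: open_gt.
Qed.

Lemma open_preim_gt f (a : R) : continuous f -> open [set x | f x < a].
Proof.
move=> cf; have := @open_comp _ _ f [set t | t < a] (fun x _ => cf x).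
by apply; exact: open_lt.
Qed.

Lemma closed_preim_le f (a : R) : continuous f -> closed [set x | a <= f x].
Proof.
move=> cf; have := @preimage_closed _ _ f [set t | a <= t] (fun x _ => cf x).
by apply; exact: closed_ge.
Qed.

Lemma closed_preim_ge f (a : R) : continuous f -> closed [set x | f x <= a].
Proof.
move=> cf; have := @preimage_closed _ _ f [set t | t <= a] (fun x _ => cf x).
by apply; exact: closed_le.
Qed.

Lemma C_bP f : C_b f <-> continuous f /\ exists M, forall x, `|f x| <= M.
Proof.
split=> -[cf bf]; split => //.
  by have [M [_ /(_ (M + 1))fM]] := bf; exists (M + 1) => x; apply: fM => //=; rewrite ltrDl.
have [M fM] := bf; exists M; split; first exact: num_real.
by move=> N MN x _ /=; rewrite (le_trans (fM x))// ltW.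
Qed.

End continuity.

Section urysohn.
Context {R : realType} {X : topologicalType}.
Hypothesis hX : hausdorff_space X.
Hypothesis lcX : locally_compact [set: X].

(** Normality of the one-point compactification separates [K] from the complement of [U], which
    contains the point at infinity. The separating function is then steepened, so as to be 1 on an
    open neighbourhood of [K] and to have compact support inside [U]. *)
Lemma urysohn_lc (K U : set X) : compact K -> open U -> K `<=` U ->
  exists f : X -> R, [/\ f \in C_c_pred, supp f `<=` U,
    forall x, 0 <= f x <= 1 &
    exists V, [/\ open V, K `<=` V & forall x, V x -> f x = 1]].
Proof.
move=> cK oU KU; pose S : X -> one_point_compactification X := Some.
have hopc := one_point_compactification_hausdorff lcX hX.
have copc := @one_point_compactification_compact X.
have cS : continuous S by exact: one_point_compactification_some_continuous.
have clA : closed (S @` K).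
  by apply: compact_closed => //; apply: continuous_compact => //; apply: continuous_subspaceT.
have clB : closed (~` (S @` U)).
  by apply: open_closedC; exact: one_point_compactification_open_some.
have AB0 : ~` (S @` U) `&` (S @` K) = set0.
  by rewrite -subset0 => z [nU [x Kx xz]]; apply: nU; exists x => //; exact: KU.
have /normal_separatorP := @compact_normal _ hopc copc.
move=> /(_ R _ _ clB clA AB0) /(@uniform_separatorP _ R)[g [cg g01 gB gA]].
pose f0 := g \o S.
have cf0 : continuous f0 by move=> x; apply: continuous_comp; [exact: cS|exact: cg].
(* [g] is below 1/3 near the added point, so the set where [f0 >= 1/3] lies in a compact set. *)
have [W [cW clW WE]] : exists W, [/\ compact W, closed W &
    [set x | 1/3 <= f0 x] `<=` W].
  have : nbhs (None : one_point_compactification X) [set z | g z < 1/3].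
    apply: open_nbhs_nbhs; split; first exact: open_preim_gt.
    rewrite /= (_ : g None = 0); first by lra.
    by apply: gB; exists None => // -[].
  move=> [W [cW clW] WE]; exists W; split => // x /=; apply: contraPP => nWx.
  by apply/negP; rewrite -ltNge; apply: (WE (S x)); left; exists x.
(* The affine map sends 1/3 to 0 and 2/3 to 1: the support stays in [1/3 <= f0], and the value is 1
   on the open set [2/3 < f0]. *)
pose f x := Num.max 0 (Num.min 1 (3 * f0 x - 1)).
have cf : continuous f.
  apply: continuous_maxf; first exact: continuous_cstf.
  apply: continuous_minf; first exact: continuous_cstf.
  apply: continuous_subf; last exact: continuous_cstf.
  by apply: continuous_mulf => //; exact: continuous_cstf.
have sf : supp f `<=` [set x | 1/3 <= f0 x].
  apply: supp_sub; first exact: closed_preim_le.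
  move=> x; apply: contraNT; rewrite -ltNge => f0x; apply/eqP.
  by rewrite /f max_l// ge_min; apply/orP; right; lra.
exists f; split.
- apply/asboolP; split => //.
  by apply: (subclosed_compact _ cW); [exact: closed_supp|exact: subset_trans WE].
- apply: (subset_trans sf) => x /=; apply: contraPP => nUx; apply/negP.
  rewrite /f0 /= (_ : g (S x) = 0); first by rewrite -ltNge; lra.
  by apply: gB; exists (S x) => // -[y Uy [yx]]; apply: nUx; rewrite -yx.
- by move=> x; rewrite /f le_max lexx /= ge_max ler01 ge_min lexx.
- exists [set x | 2/3 < f0 x]; split; first exact: open_preim_lt.
    move=> x Kx /=; rewrite /f0/= (_ : g (S x) = 1); first by lra.
    by apply: gA; exists (S x) => //; exists x.
  by move=> x /= f0x; rewrite /f min_l ?max_r//; lra.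
Qed.

End urysohn.

(** * Singly generated subalgebras *)

Section norm_approximation.
Context {R : realType}.
Implicit Types (s e : R) (n : nat).

(** The iteration from the Stone-Weierstrass theorem: polynomials in [s], without constant term,
    that increase to [|s|] on [-1, 1]. *)
Fixpoint norm_approx n s : R :=
  if n is m.+1 then norm_approx m s + (s ^+ 2 - norm_approx m s ^+ 2) / 2
  else 0.

(** If [d] is the error of [q], the next error is [d (1 - (|s| + q) / 2) <= d (1 - d / 2)], and
    [x (1 - x / 2)] increases on [0, 1]; the bound closes up because
    [(n + 1) (n + 3) <= (n + 2)^2]. *)
Lemma norm_approx_bound n s : `|s| <= 1 ->
  0 <= norm_approx n s <= `|s| /\ `|s| - norm_approx n s <= 2 / (n%:R + 2).
Proof.
move=> s1; have s0 := normr_ge0 s; elim: n => [|n [/andP[q0 qs] IH]].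
  by rewrite /= lexx s0 add0r divff//; split => //; lra.
have n0 : 0 <= n%:R :> R by rewrite ler0n.
rewrite [norm_approx _ _]/= -[s ^+ 2]real_normK ?num_real//.
move: (norm_approx n s) (`|s|) q0 qs IH s1 s0 => q t q0 qt IH t1 t0.
split; first by apply/andP; split; nra.
have h : t - (q + (t ^+ 2 - q ^+ 2) / 2) <= (t - q) * (1 - (t - q) / 2).
  by nra.
apply: (le_trans h); rewrite -natr1.
set a := 2 / (n%:R + 2) in IH.
have a1 : a <= 1 by rewrite /a ler_pdivrMr; lra.
have : (t - q) * (1 - (t - q) / 2) <= a * (1 - a / 2) by nra.
move=> /le_trans; apply; rewrite /a.
have -> : 1 - 2 / (n%:R + 2) / 2 = (n%:R + 1) / (n%:R + 2) :> R.
  by field; lra.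
rewrite mulf_div ler_pdivrMr; last by nra.
rewrite mulrAC ler_pdivlMr; last by lra.
by nra.
Qed.

End norm_approximation.

Section singly_generated_facts.
Context {R : realType} {X : topologicalType}.
Implicit Types (f g h : X -> R) (A : set (X -> R)).

Lemma closed_uniformP A : closed (A : set {uniform X -> R}) <->
  forall f, (forall e, 0 < e -> exists2 g, A g & forall x, `|f x - g x| < e) ->
  A f.
Proof.
split=> [cA f fA|fA].
  apply: (cA f) => V /uniform_nbhs[E [entE EV]].
  move: entE; rewrite -entourage_ballE => -[e /= e0 eE].
  have [g Ag fg] := fA _ e0; exists g; split => //.
  by apply: EV => x _; apply: eE; exact: fg.
move=> f fcl; apply: fA => e e0.
have [|g [Ag fg]] := fcl [set g | forall x, `|f x - g x| < e].
  apply/uniform_nbhs; exists [set xy | ball xy.1 e xy.2]; split.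
    by rewrite -entourage_ballE; exists e.
  by move=> g fg x; exact: fg.
by exists g.
Qed.

Section closed_subalgebra_facts.
Variable A : set (X -> R).
Hypothesis cA : closed_subalgebra A.

Lemma subalg_add f g : A f -> A g -> A (fun x => f x + g x).
Proof.
move=> Af Ag; have [_ _ AD _ _] := cA; have := AD 1 f g Af Ag.
by congr A; apply/funext => x; rewrite !fctE scale1r.
Qed.

Lemma subalg_scale (a : R) f : A f -> A (fun x => a * f x).
Proof.
move=> Af; have [_ A0 AD _ _] := cA; have := AD a f _ Af A0.
by congr A; apply/funext => x; rewrite !fctE addr0.
Qed.

Lemma subalg_sub f g : A f -> A g -> A (fun x => f x - g x).
Proof.
move=> Af Ag; have := subalg_add _ _ Af (subalg_scale (-1) _ Ag).
by congr A; apply/funext => x; rewrite mulN1r.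
Qed.

(** Without constants in the algebra, [f] itself may be outside while [f - a] is inside. The
    identity [g^2 - b^2 = (g - b)^2 + 2 b (g - b)] keeps every difference of iterates inside. *)
Lemma subalg_norm_approx f (a : R) n : A (fun x => f x - a) ->
  A (fun x => norm_approx n (f x) - norm_approx n a).
Proof.
move=> Af; have [_ A0 _ AM _] := cA.
have AB (g : X -> R) b : A (fun x => g x - b) -> A (fun x => g x ^+ 2 - b ^+ 2).
  move=> Ag; have := subalg_add _ _ (AM _ _ Ag Ag) (subalg_scale (2 * b) _ Ag).
  by congr A; apply/funext => x /=; ring.
elim: n => [|n IH] /=; first by under eq_fun do rewrite subr0.
have := subalg_add _ _ IH (subalg_scale (1/2) _ (subalg_sub _ _ (AB _ _ Af) (AB _ _ IH))).
by congr A; apply/funext => x /=; field.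
Qed.

(** For [c >= 0] the positive part is [f / 2 + (|f - c| - |- c|) / 2], a form in which no constant
    function occurs on its own. *)
Lemma subalg_excess f (c : R) : 0 <= c -> A f ->
  A (fun x => Num.max (f x - c) 0).
Proof.
move=> c0 Af; have [AC _ _ _ /closed_uniformP clA] := cA.
apply: clA => e e0; have [_ [M fM]] := (C_bP _).1 (AC _ Af).
(* [L] bounds both [|f - c|] and [c], so that [s] and [t] below fall in [-1, 1]. *)
pose L := `|M| + c + 1.
have L0 : 0 < L by rewrite /L; have := normr_ge0 M; lra.
have M0 := ler_norm M.
have [n nL] : exists n : nat, 2 * L / e < n%:R.
  exists (Num.truncn (2 * L / e)).+1.
  by have := @truncnS_gt R (2 * L / e).
pose s x := (f x - c) / L; pose t := - c / L.
have As : A (fun x => s x - t).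
  have := subalg_scale L^-1 _ Af; congr A; apply/funext => x.
  by rewrite /s /t; field; lra.
have Ap := subalg_scale (L / 2) _ (subalg_norm_approx s t n As).
exists (fun x => 1 / 2 * f x + L / 2 * (norm_approx n (s x) - norm_approx n t)).
  exact: subalg_add (subalg_scale _ _ Af) Ap.
have nL2 : L * (2 / (n%:R + 2)) < e.
  rewrite mulrA ltr_pdivrMr; last by have := ler0n R n; lra.
  by move: nL; rewrite ltr_pdivrMr//; nra.
have approxE (u : R) : `|u| <= L ->
    0 <= `|u| - L * norm_approx n (u / L) <= L * (2 / (n%:R + 2)).
  move=> uL; have u1 : `|u / L| <= 1.
    by rewrite normrM normfV (gtr0_norm L0) ler_pdivrMr// mul1r.
  have [/andP[_ q1] q2] := norm_approx_bound n _ u1.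
  have uE : `|u| = L * `|u / L|.
    by rewrite normrM normfV (gtr0_norm L0) mulrCA divff ?mulr1//; lra.
  by rewrite uE -mulrBr; apply/andP; split; [apply: mulr_ge0; lra|rewrite ler_pM2l].
move=> x.
have fxM : `|f x| <= M := fM x.
have /approxE : `|f x - c| <= L.
  by rewrite (le_trans (ler_normB _ _))// (ger0_norm c0) /L; lra.
have /approxE : `|- c| <= L by rewrite normrN ger0_norm// /L; have := normr_ge0 M; lra.
rewrite normrN (ger0_norm c0) -/(s x) -/t.
move: (norm_approx n (s x)) (norm_approx n t) => qs qt.
move: (L * (2 / _)) nL2 => d de /andP[t1 t2] /andP[s1 s2].
have -> : Num.max (f x - c) 0 = (f x - c + `|f x - c|) / 2.
  by have [h|h] := leP 0 (f x - c); [rewrite ger0_norm|rewrite ltr0_norm]; lra.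
by rewrite ltr_norml; apply/andP; split; lra.
Qed.

End closed_subalgebra_facts.

Lemma generated_excess h (c : R) : 0 <= c ->
  singly_generated h (fun x => Num.max (h x - c) 0).
Proof.
by move=> c0 A [[cA _] hA]; apply: subalg_excess => //; exact: hA.
Qed.

Lemma generated_self h : singly_generated h h.
Proof. by move=> A [_ hA]; exact: hA. Qed.

Lemma generated_sub h f g : singly_generated h f -> singly_generated h g ->
  singly_generated h (fun x => f x - g x).
Proof.
by move=> hf hg A hA; apply: (subalg_sub _ hA.1.1); [exact: hf|exact: hg].
Qed.

(** Functions constant on the fibres of [h], and zero where [h] is zero if constants are not
    adjoined, form a closed subalgebra containing [h]. This replaces the description of the
    generated algebra by functions [phi o h]. *)
Lemma generated_fibres h f : C_b h -> singly_generated h f ->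
  (forall x y, h x = h y -> f x = f y) /\
  (~ compact [set: X] -> forall x, h x = 0 -> f x = 0).
Proof.
move=> Ch /(_ [set g | C_b g /\ ((forall x y, h x = h y -> g x = g y) /\
  (~ compact [set: X] -> forall x, h x = 0 -> g x = 0))]) [|_ []//].
split; last by move=> _ -> /=; split.
split; last first.
  move=> cX; split; last by split => // /(_ cX).
  by apply/C_bP; split; [exact: continuous_cstf|exists 1 => x /=; rewrite normr1].
split.
- by move=> g [].
- by split=> //; apply/C_bP; split; [exact: continuous_cstf|exists 0 => x /=; rewrite normr0].
- move=> a f1 f2 [/C_bP[c1 [M1 M1P]] [p1 z1]] [/C_bP[c2 [M2 M2P]] [p2 z2]]; split.
    apply/C_bP; split; first exact: continuous_lincomb.
    exists (`|a| * M1 + M2) => x; apply: (le_trans (ler_normD _ _)).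
    by rewrite normrM lerD// ler_wpM2l.
  split=> [x y hxy|ncX x hx]; first by rewrite !fctE (p1 x y)// (p2 x y).
  by rewrite !fctE z1// z2// scaler0 addr0.
- move=> f1 f2 [/C_bP[c1 [M1 M1P]] [p1 z1]] [/C_bP[c2 [M2 M2P]] [p2 z2]]; split.
    apply/C_bP; split; first exact: continuous_mulf.
    by exists (M1 * M2) => x /=; rewrite normrM ler_pM.
  split=> [x y hxy|ncX x hx] /=; first by rewrite (p1 x y)// (p2 x y).
  by rewrite z1// mul0r.
apply/closed_uniformP => g gA; split; last first.
  split=> [x y hxy|ncX x hx].
    apply/eqP; rewrite -subr_eq0 -normr_le0; apply/ler_addgt0Pl => e e0.
    have [|u [_ [uf _]] gu] := gA (e / 2); first by lra.
    have := gu x; have := gu y; rewrite (uf x y)// addr0 !ltr_norml ler_norml.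
    by move=> /andP[? ?] /andP[? ?]; apply/andP; split; lra.
  apply/eqP; rewrite -normr_le0; apply/ler_addgt0Pl => e e0.
  have [u [_ [_ uz]] gu] := gA e e0.
  by have := gu x; rewrite uz// subr0 addr0 => /ltW.
apply/C_bP; split.
  move=> x; apply/cvgrPdist_lt => e e0.
  have [|u [/C_bP[cu _] _] gu] := gA (e / 3); first by lra.
  have /cvgrPdist_lt/(_ (e / 3)) := cu x; rewrite divr_gt0// => /(_ isT).
  apply: filterS => y; have := gu x; have := gu y; rewrite !ltr_norml.
  by move=> /andP[? ?] /andP[? ?] /andP[? ?]; apply/andP; split; lra.
have [u [/C_bP[_ [M uM]] _] gu] := gA 1 ltr01.
exists (M + 1) => x; have := uM x; have := gu x; rewrite !ltr_norml !ler_norml.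
by move=> /andP[? ?] /andP[? ?]; apply/andP; split; lra.
Qed.

End singly_generated_facts.

(** * Quasi-linear functionals *)

Section truncation.
Context {R : realType} {X : Type}.
Implicit Types (f : X -> R) (c : R).

Definition excess f c x := Num.max (f x - c) 0.
Definition trunc f c x := Num.min (f x) c.

Lemma excess_ge0 f c x : 0 <= excess f c x.
Proof. by rewrite /excess le_max lexx orbT. Qed.

Lemma truncE f c : trunc f c = (fun x => f x - excess f c x).
Proof.
apply/funext => x; rewrite /trunc /excess.
by have [h|h] := leP (f x) c; [rewrite max_r|rewrite max_l]; lra.
Qed.

Lemma excessE f c x : excess f c x = if f x <= c then 0 else f x - c.
Proof. by rewrite /excess; have [h|h] := leP (f x) c; [rewrite max_r|rewrite max_l]; lra. Qed.

Lemma trunc_le f c x : trunc f c x <= c.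
Proof. by rewrite /trunc ge_min lexx orbT. Qed.

Lemma trunc_lef f c x : trunc f c x <= f x.
Proof. by rewrite /trunc ge_min lexx. Qed.

Lemma trunc_ge0 f c x : 0 <= c -> 0 <= f x -> 0 <= trunc f c x.
Proof. by move=> c0 fx; rewrite /trunc le_min fx. Qed.

Lemma excess_excess f b c : 0 <= c ->
  excess (excess f b) c = excess f (b + c).
Proof.
move=> c0; apply/funext => x; rewrite !excessE.
have [h1|h1] := leP (f x) b; have [h2|h2] := leP (f x) (b + c); rewrite ?c0//; first lra.
  by rewrite ifT//; lra.
by rewrite ifF; lra.
Qed.

Lemma excess_comm f b c : 0 <= b -> 0 <= c ->
  excess (excess f b) c = excess (excess f c) b.
Proof. by move=> b0 c0; rewrite !excess_excess// addrC. Qed.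

End truncation.

Section spaces.
Context {R : realType} {X : topologicalType}.
Implicit Types f g : X -> R.

Lemma C_c_sub_C_0 : {subset C_c_pred <= @C_0_pred R X}.
Proof.
move=> f /asboolP[cf sf]; apply/asboolP; split => // e e0.
apply: (subclosed_compact _ sf).
  have cn : continuous (fun x => `|f x|).
    by move=> x; apply: (@continuous_comp _ _ _ f Num.norm); [exact: cf|exact: norm_continuous].
  exact: closed_preim_le.
by move=> x /= fx; apply: supp_neq0; rewrite -normr_gt0; exact: lt_le_trans fx.
Qed.

Lemma C_0_bounded f : f \in @C_0_pred R X -> exists M, forall x, `|f x| <= M.
Proof.
move=> /asboolP[cf /(_ 1 ltr01) cK].
have [[y Ky]|nK] := pselect ([set x | 1 <= `|f x|] !=set0); last first.
  exists 1 => x; rewrite leNgt; apply/negP => fx; apply: nK; exists x.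
  exact: ltW.
have cn : {within [set x | 1 <= `|f x|], continuous (fun x => `|f x|)}.
  apply: continuous_subspaceT => x.
  by apply: (@continuous_comp _ _ _ f Num.norm); [exact: cf|exact: norm_continuous].
have [|z _ zM] := compact_EVT_max _ cK cn; first by exists y.
exists (Num.max 1 `|f z|) => x; rewrite le_max.
by have [//|/ltW fx] := leP `|f x| 1; rewrite zM ?orbT// inE.
Qed.

Lemma C_0_C_b f : f \in @C_0_pred R X -> C_b f.
Proof.
by move=> fC; apply/C_bP; split; [case/asboolP: fC|exact: C_0_bounded].
Qed.

Lemma C_0_compact_lt f c : f \in @C_0_pred R X -> 0 < c ->
  compact [set x | c <= f x].
Proof.
move=> /asboolP[cf fK] c0; apply: (subclosed_compact _ (fK _ c0)).
  exact: closed_preim_le.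
by move=> x /= cfx; rewrite (le_trans cfx)// ler_norm.
Qed.

(** What [C_0] and [C_c] share; [solid_le] makes them order ideals among the continuous functions.
    Most of the theory of functionals is developed once, for such a space. *)
Record solid_space (P : {pred X -> R}) : Prop := SolidSpace {
  solid_C_c : {subset @C_c_pred R X <= P};
  solid_C_0 : {subset P <= @C_0_pred R X};
  solid_lincomb : forall (a b : R) f g, f \in P -> g \in P ->
    (fun x => a * f x + b * g x) \in P;
  solid_le : forall f g, f \in P -> continuous g ->
    (forall x, `|g x| <= `|f x|) -> g \in P }.

Lemma C_0_solid : solid_space (@C_0_pred R X).
Proof.
split => //; first exact: C_c_sub_C_0.
- move=> a b f g fC gC.
  have : a *: f + b *: g \in @C_0_pred R X by rewrite rpredD ?rpredZ.
  by [].
- move=> f g /asboolP[cf fK] cg gf; apply/asboolP; split => // e e0.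
  apply: (subclosed_compact _ (fK _ e0)).
    have cn : continuous (fun x => `|g x|).
      by move=> x; apply: (@continuous_comp _ _ _ g Num.norm); [exact: cg|exact: norm_continuous].
    exact: closed_preim_le.
  by move=> x /= egx; exact: le_trans (gf x).
Qed.

Lemma C_c_solid : solid_space (@C_c_pred R X).
Proof.
split => //; first exact: C_c_sub_C_0.
- move=> a b f g fC gC.
  have : a *: f + b *: g \in @C_c_pred R X by rewrite rpredD ?rpredZ.
  by [].
- move=> f g /asboolP[cf fK] cg gf; apply/asboolP; split => //.
  apply: (subclosed_compact _ fK); first exact: closed_supp.
  apply: supp_sub; first exact: closed_supp.
  move=> x gx; apply: supp_neq0; apply: contraNneq gx => fx.
  by rewrite -normr_le0 (le_trans (gf x))// fx normr0.
Qed.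

End spaces.

Section quasi_linear_functional.
Context {R : realType} {X : topologicalType}.
Variable P : {pred X -> R}.
Hypothesis sP : solid_space P.
Implicit Types (f g h : X -> R) (r : (X -> R) -> R).

(** Functionals act on all functions, with conditions only on [P]; an expression such as [f - g] can
    then be written down before its membership in [P] is known. *)
Record qlf r : Prop := Qlf {
  qlf_scale : forall a f, f \in P -> r (fun x => a * f x) = a * r f;
  qlf_add : forall h f g, h \in P -> f \in P -> g \in P ->
    singly_generated h f -> singly_generated h g ->
    r (fun x => f x + g x) = r f + r g;
  qlf_ge0 : forall f, f \in P -> (forall x, 0 <= f x) -> 0 <= r f }.

(** A substitute for continuity in the uniform norm, which allows the bottom slice of [f] to be
    neglected. The constant depends on [f], as a functional on [C_c] may have infinite norm. *)
Definition small_tails r := forall f, f \in P -> (forall x, 0 <= f x) ->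
  exists M, forall e, 0 < e -> r (trunc f e) <= e * M.

Lemma solid_cont f : f \in P -> continuous f.
Proof. by move=> /(solid_C_0 _ sP)/asboolP[]. Qed.

Lemma solid_add f g : f \in P -> g \in P -> (fun x => f x + g x) \in P.
Proof.
move=> fP gP; have := solid_lincomb _ sP 1 1 _ _ fP gP.
by congr (_ \in P); apply/funext => x; rewrite !mul1r.
Qed.

Lemma solid_sub f g : f \in P -> g \in P -> (fun x => f x - g x) \in P.
Proof.
move=> fP gP; have := solid_lincomb _ sP 1 (-1) _ _ fP gP.
by congr (_ \in P); apply/funext => x; rewrite mul1r mulN1r.
Qed.

Lemma solid_scale (a : R) f : f \in P -> (fun x => a * f x) \in P.
Proof.
move=> fP; have := solid_lincomb _ sP a 0 _ _ fP fP.
by congr (_ \in P); apply/funext => x; rewrite mul0r addr0.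
Qed.

Lemma solid_excess f c : f \in P -> 0 <= c -> excess f c \in P.
Proof.
move=> fP c0; apply: (solid_le _ sP f) => //.
  apply: continuous_maxf; last exact: continuous_cstf.
  by apply: continuous_subf; [exact: solid_cont|exact: continuous_cstf].
move=> x; rewrite excessE; have [cfx|cfx] := leP (f x) c; rewrite ?normr0//.
by rewrite !ger0_norm; lra.
Qed.

Lemma solid_trunc f c : f \in P -> 0 <= c -> trunc f c \in P.
Proof. by move=> fP c0; rewrite truncE solid_sub// solid_excess. Qed.

Section facts.
Variable r : (X -> R) -> R.
Hypothesis qr : qlf r.

Lemma qlf0 : r (fun=> 0) = 0.
Proof.
have P0 : (fun=> 0) \in P.
  apply: (solid_C_c _ sP); exact: (rpred0 (@C_c_pred R X)).
have := qlf_scale _ qr 0 _ P0; by rewrite !mul0r.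
Qed.

Lemma qlf_sub h f g : h \in P -> f \in P -> g \in P ->
  singly_generated h f -> singly_generated h g ->
  r (fun x => f x - g x) = r f - r g.
Proof.
move=> hP fP gP hf hg; apply/eqP; rewrite eq_sym subr_eq; apply/eqP.
rewrite -(qlf_add _ qr h)//; [|exact: solid_sub|exact: generated_sub].
by congr r; apply/funext => x; rewrite subrK.
Qed.

Lemma qlf_trunc f c : f \in P -> 0 <= c ->
  r f = r (trunc f c) + r (excess f c).
Proof.
move=> fP c0; rewrite truncE (qlf_sub f) ?subrK//.
- exact: solid_excess.
- exact: generated_self.
- exact: generated_excess.
Qed.

Lemma qlf_pos_neg f : f \in P ->
  r f = r (excess f 0) - r (excess (fun x => - f x) 0).
Proof.
move=> fP.
have -> : excess (fun x => - f x) 0 = (fun x => excess f 0 x - f x).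
  apply/funext => x; rewrite !excessE.
  by have [h|h] := leP (f x) 0; have [k|k] := leP (- f x) 0; lra.
rewrite (qlf_sub f) ?subKr//.
- exact: solid_excess.
- exact: generated_excess.
- exact: generated_self.
Qed.

(* With [h = f - g] both functions lie in [S(h)], since [f = h^+]. *)
Lemma qlf_disjoint f g : f \in P -> g \in P ->
  (forall x, 0 <= f x) -> (forall x, 0 <= g x) ->
  (forall x, f x = 0 \/ g x = 0) -> r (fun x => f x + g x) = r f + r g.
Proof.
move=> fP gP f0 g0 fg; pose h x := f x - g x.
have hP : h \in P by exact: solid_sub.
have fE : f = excess h 0.
  apply/funext => x; have := f0 x; have := g0 x; rewrite excessE.
  by have [k|k] := leP (h x) 0; move: k; rewrite /h; case: (fg x) => ->; lra.
have hf : singly_generated h f by rewrite fE; exact: generated_excess.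
apply: (qlf_add _ qr h) => //.
have -> : g = (fun x => f x - h x) by apply/funext => x; rewrite /h; lra.
by apply: generated_sub => //; exact: generated_self.
Qed.

(* With [h = f + g], the hypotheses give [f = (h - c)^+]. *)
Lemma qlf_stacked f g c : f \in P -> g \in P -> 0 <= c ->
  (forall x, 0 <= f x) -> (forall x, g x <= c) ->
  (forall x, f x = 0 \/ g x = c) -> r (fun x => g x - f x) = r g - r f.
Proof.
move=> fP gP c0 f0 gc fg; pose h x := f x + g x.
have hP : h \in P by exact: solid_add.
have fE : f = excess h c.
  apply/funext => x; have := f0 x; have := gc x; rewrite excessE.
  by have [k|k] := leP (h x) c; move: k; rewrite /h; case: (fg x) => ->; lra.
have hf : singly_generated h f by rewrite fE; exact: generated_excess.
apply: (qlf_sub h) => //.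
have -> : g = (fun x => h x - f x) by apply/funext => x; rewrite /h; lra.
by apply: generated_sub => //; exact: generated_self.
Qed.

Lemma qlf_stacked_le f g c : f \in P -> g \in P -> 0 <= c ->
  (forall x, 0 <= f x <= g x) -> (forall x, g x <= c) ->
  (forall x, f x = 0 \/ g x = c) -> r f <= r g.
Proof.
move=> fP gP c0 f0g gc fg; rewrite -subr_ge0 -(qlf_stacked f g c)//.
  apply: (qlf_ge0 _ qr); first exact: solid_sub.
  by move=> x; have /andP[_] := f0g x; rewrite subr_ge0.
by move=> x; have /andP[] := f0g x.
Qed.

Hypothesis tr : small_tails r.

(** The slice below height [k e] costs at most [k e M], which tends to 0 with [e]. The factor [k]
    accommodates comparisons that lose one or two steps. *)
Lemma le_of_small_tails f (a : R) (k : R) : f \in P -> (forall x, 0 <= f x) ->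
  0 < k -> (forall e, 0 < e -> r (excess f (k * e)) <= a) -> r f <= a.
Proof.
move=> fP f0 k0 fa; have [M fM] := tr f fP f0.
apply/ler_addgt0Pl => e e0.
have M1 : 0 < `|M| + 1 by rewrite ltr_wpDl.
pose d := e / (k * (`|M| + 1)).
have d0 : 0 < d by rewrite divr_gt0// mulr_gt0.
have kd0 : 0 < k * d by rewrite mulr_gt0.
rewrite (qlf_trunc f (k * d))//; last exact: ltW.
apply: lerD; last exact: fa.
apply: le_trans (fM _ kd0) _.
have -> : k * d = e / (`|M| + 1) by rewrite /d; field; lra.
rewrite mulrAC ler_pdivrMr// ler_pM2l//.
by have := ler_norm M; lra.
Qed.

(** Where the layer of [f] between [e] and [2 e] is nonzero, [g >= f > e], so the bottom layer of
    [g] has its full height there. For the bottom layers of both functions this would fail, hence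
    the offset by one step. *)
Lemma layer_le f g e : 0 < e -> f \in P -> g \in P ->
  (forall x, 0 <= f x) -> (forall x, f x <= g x) ->
  r (trunc (excess f e) e) <= r (trunc g e).
Proof.
move=> e0 fP gP f0 fg; have e0' := ltW e0; apply: (qlf_stacked_le _ _ e) => //.
- by apply: solid_trunc => //; apply: solid_excess.
- exact: solid_trunc.
- move=> x; rewrite trunc_ge0//=; last exact: excess_ge0.
  rewrite le_min trunc_le andbT; apply: le_trans (trunc_lef _ _ _) _.
  have := f0 x; have := fg x; rewrite excessE.
  by have [h|h] := leP (f x) e; lra.
- by move=> x; exact: trunc_le.
- move=> x; have := fg x; rewrite /trunc excessE; have [fe|fe] := leP (f x) e => fgx.
    by left; rewrite min_l.
  by right; rewrite min_r//; lra.
Qed.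

(** The second layer of [f] is matched with the first of [g]; then both functions drop by one step,
    which preserves [f <= g]. *)
Lemma qlf_excess_le e n f g : 0 < e -> f \in P -> g \in P ->
  (forall x, 0 <= f x) -> (forall x, f x <= g x) ->
  (forall x, f x <= n%:R * e) -> r (excess f e) <= r g.
Proof.
move=> e0; have e0' := ltW e0.
elim: n f g => [|n IH] f g fP gP f0 fg fn.
  rewrite (_ : excess f e = fun=> 0) ?qlf0//.
    apply: (qlf_ge0 _ qr) => // x; exact: le_trans (fg x).
  by apply/funext => x; rewrite excessE; have := fn x; have [h|h] := leP (f x) e; lra.
have fe : excess f e \in P by exact: solid_excess.
have ge : excess g e \in P by exact: solid_excess.
rewrite (qlf_trunc (excess f e) e)// (qlf_trunc g e)//.
apply: lerD; first exact: layer_le.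
apply: IH => //.
- by move=> x; exact: excess_ge0.
- move=> x; have := fg x; rewrite !excessE.
  by have [h|h] := leP (f x) e; have [k|k] := leP (g x) e; lra.
- move=> x; have := fn x; rewrite excessE -natr1.
  have : 0 <= n%:R * e by rewrite mulr_ge0// ler0n.
  by have [h|h] := leP (f x) e; lra.
Qed.

Lemma bounded_steps f e : f \in P -> 0 < e ->
  exists n : nat, forall x, f x <= n%:R * e.
Proof.
move=> /(solid_C_0 _ sP)/C_0_bounded[M fM] e0.
exists (Num.truncn (M / e)).+1 => x; apply: le_trans (ler_norm _) _.
apply: le_trans (fM x) _; rewrite -ler_pdivrMr//.
by have := @truncnS_gt R (M / e) => /ltW.
Qed.

Lemma qlf_le f g : f \in P -> g \in P ->
  (forall x, 0 <= f x) -> (forall x, f x <= g x) -> r f <= r g.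
Proof.
move=> fP gP f0 fg; apply: (le_of_small_tails f _ 1) => // e e0.
have [n fn] := bounded_steps f e fP e0.
by rewrite mul1r; apply: (qlf_excess_le e n).
Qed.

End facts.
End quasi_linear_functional.

(** * The set function of a quasi-linear functional *)

Section subordinate_functions.
Context {R : realType} {X : topologicalType}.
Hypothesis hX : hausdorff_space X.
Hypothesis lcX : locally_compact [set: X].
Implicit Types (f g h : X -> R) (U V K : set X).

Definition subord U f :=
  [/\ f \in C_c_pred, forall x, 0 <= f x <= 1 & supp f `<=` U].

Lemma subord_cont U f : subord U f -> continuous f.
Proof. by case=> /asboolP[]. Qed.

Lemma subord_compact U f : subord U f -> compact (supp f).
Proof. by case=> /asboolP[]. Qed.

Lemma subord_sub U V f : U `<=` V -> subord U f -> subord V f.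
Proof. by move=> UV [fC f01 fU]; split => //; exact: subset_trans UV. Qed.

Lemma subord_le U f g : subord U f -> continuous g ->
  (forall x, 0 <= g x <= f x) -> subord U g.
Proof.
move=> [fC f01 fU] cg gf.
have gfn x : `|g x| <= `|f x|.
  have /andP[g0 gfx] := gf x.
  by rewrite !ger0_norm//; exact: le_trans gfx.
split; first exact: (solid_le _ C_c_solid f).
  move=> x; have /andP[-> gfx] := gf x; apply: le_trans gfx _.
  by have /andP[] := f01 x.
apply: subset_trans fU; apply: supp_sub; first exact: closed_supp.
move=> x gx; apply: supp_neq0; apply: contraNneq gx => fx.
by rewrite -normr_le0 (le_trans (gfn x))// fx normr0.
Qed.

Lemma subord_max U f g : subord U f -> subord U g ->
  subord U (fun x => Num.max (f x) (g x)).
Proof.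
move=> bf bg; have [fC f01 fU] := bf; have [gC g01 gU] := bg.
have cm : continuous (fun x => Num.max (f x) (g x)).
  by apply: continuous_maxf; [exact: subord_cont bf|exact: subord_cont bg].
split.
- apply: (solid_le _ C_c_solid _ _ (solid_add _ C_c_solid _ _ fC gC)) => // x.
  have /andP[? ?] := f01 x; have /andP[? ?] := g01 x.
  rewrite !ger0_norm; [|lra|by rewrite le_max; apply/orP; left].
  by rewrite ge_max; apply/andP; split; lra.
- move=> x; have /andP[f0 f1] := f01 x; have /andP[g0 g1] := g01 x.
  by rewrite le_max f0 ge_max f1 g1.
- apply: (@subset_trans _ (supp f `|` supp g)); last by move=> x [/fU|/gU].
  apply: supp_sub; first by apply: closedU; exact: closed_supp.
  move=> x; apply: contraPP => /not_orP[nf ng] /eqP; apply.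
  by rewrite (supp_eq0 f)// (supp_eq0 g)// maxxx.
Qed.

(** Cut [f] by a function [h] that is 1 on a neighbourhood [N] of the part of [supp f] outside [V],
    a compact subset of [U]: then [h f] lives in [U], and the support of [(1 - h) f] avoids [N],
    hence lies in [V]. *)
Lemma subord_split U V f : open U -> open V -> subord (U `|` V) f ->
  exists f1 f2, [/\ subord U f1, subord V f2 & f = (fun x => f1 x + f2 x)].
Proof.
move=> oU oV bf; have [fC f01 fUV] := bf.
have cK : compact (supp f `\` V).
  apply: (@subclosed_compact _ _ (supp f)); [|exact: subord_compact bf|by move=> x []].
  by rewrite setDE; apply: closedI; [exact: closed_supp|exact: open_closedC].
have [|h [hC hU h01 [N [oN KN hN]]]] := urysohn_lc (R := R) hX lcX _ U cK oU.
  by move=> x [/fUV[]].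
have ch : continuous h by case/asboolP: hC.
have cf := subord_cont _ _ bf.
exists (fun x => h x * f x), (fun x => (1 - h x) * f x); split.
- apply: (subord_le U h) => //; first exact: continuous_mulf.
  move=> x; have /andP[? ?] := f01 x; have /andP[? ?] := h01 x.
  by apply/andP; split; nra.
- have cg : continuous (fun x => (1 - h x) * f x).
    by apply: continuous_mulf => //; apply: continuous_subf => //; exact: continuous_cstf.
  have [|gC g01 _] := subord_le _ _ _ bf cg.
    move=> x; have /andP[? ?] := f01 x; have /andP[? ?] := h01 x.
    by apply/andP; split; nra.
  split => //; apply: (@subset_trans _ (supp f `\` N)).
    apply: supp_sub.
      by rewrite setDE; apply: closedI; [exact: closed_supp|exact: open_closedC].
    move=> x gx; split; first by apply: supp_neq0; apply: contraNneq gx => ->; rewrite mulr0.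
    by move=> /hN hx; move: gx; rewrite hx subrr mul0r eqxx.
  by move=> x [fx nN]; apply: contrapT => nV; apply: nN; apply: KN.
- by apply/funext => x; ring.
Qed.

End subordinate_functions.

Section set_function.
Context {R : realType} {X : topologicalType}.
Hypothesis hX : hausdorff_space X.
Hypothesis lcX : locally_compact [set: X].
Variable P : {pred X -> R}.
Hypothesis sP : solid_space P.
Implicit Types (f g h : X -> R) (U V K : set X).

Section one_functional.
Variable r : (X -> R) -> R.
Hypothesis qr : qlf P r.
Hypothesis tr : small_tails P r.
Local Open Scope ereal_scope.

Definition inner_mass U : \bar R :=
  ereal_sup [set (r f)%:E | f in [set f | subord U f]].

(** Defined on all subsets, so that additivity concerns bare sets instead of packaged open or closed
    ones, and so that it can serve as an outer measure when [r] is linear. *)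
Definition outer_mass (A : set X) : \bar R :=
  ereal_inf [set inner_mass U | U in [set U | open U /\ A `<=` U]].

Lemma subord_in U f : subord U f -> f \in P.
Proof. by case=> fC _ _; exact: solid_C_c. Qed.

Lemma subord_inner U f : subord U f -> (r f)%:E <= inner_mass U.
Proof. by move=> bf; apply: ereal_sup_ubound; exists f. Qed.

Lemma inner_massS U V : U `<=` V -> inner_mass U <= inner_mass V.
Proof.
move=> UV; apply: ereal_sup_le => _ [f bf <-]; exists f => //=.
exact: subord_sub bf.
Qed.

Lemma subord0 U : subord U (fun=> 0%R : R).
Proof.
split; first exact: (rpred0 (@C_c_pred R X)).
  by move=> x; rewrite lexx ler01.
apply: (@subset_trans _ set0) => //; apply: supp_sub; first exact: closed0.
by move=> x; rewrite eqxx.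
Qed.

Lemma inner_mass_ge0 U : 0 <= inner_mass U.
Proof.
by apply: le_trans (subord_inner _ _ (subord0 U)); rewrite (qlf0 P)// lexx.
Qed.

Lemma inner_mass_le U (k : X -> R) : k \in P -> (forall x, (0 <= k x)%R) ->
  (forall x, U x -> (1 <= k x)%R) -> inner_mass U <= (r k)%:E.
Proof.
move=> kP k0 k1; apply: ge_ereal_sup => _ [f bf <-]; rewrite lee_fin.
have [_ f01 fU] := bf; apply: (qlf_le P) => //; first exact: subord_in bf.
  by move=> x; have /andP[] := f01 x.
move=> x; have [/k1 kx|nUx] := pselect (U x).
  by apply: le_trans kx; have /andP[] := f01 x.
by rewrite (supp_eq0 f)// => /fU.
Qed.

Lemma outer_massS A B : A `<=` B -> outer_mass A <= outer_mass B.
Proof.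
move=> AB; apply: ereal_inf_le_tmp => _ [U [oU BU] <-]; exists U => //; split => //.
exact: subset_trans BU.
Qed.

Lemma outer_massE U : open U -> outer_mass U = inner_mass U.
Proof.
move=> oU; apply/eqP; rewrite eq_le; apply/andP; split.
  by apply: ereal_inf_lbound; exists U => //; split.
by apply: le_ereal_inf_tmp => _ [V [oV UV] <-]; exact: inner_massS.
Qed.

Lemma outer_mass_ge0 A : 0 <= outer_mass A.
Proof. by apply: le_ereal_inf_tmp => _ [U _ <-]; exact: inner_mass_ge0. Qed.

Lemma subord_outer A f : subord A f -> (r f)%:E <= outer_mass A.
Proof.
move=> bf; apply: le_ereal_inf_tmp => _ [U [oU AU] <-].
by apply: subord_inner; exact: subord_sub bf.
Qed.

Lemma outer_mass_inf A : outer_mass A =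
  ereal_inf [set outer_mass U | U in [set U | open U /\ A `<=` U]].
Proof.
by congr ereal_inf; apply/seteqP; split => _ [U [oU AU] <-]; exists U;
  rewrite ?outer_massE.
Qed.

Lemma outer_mass_compact K : compact K -> outer_mass K < +oo.
Proof.
move=> cK; have [//|h [hC _ h01 [V [oV KV hV]]]] := urysohn_lc (R := R) hX lcX K setT cK openT.
apply: (@le_lt_trans _ _ (r h)%:E); last exact: ltry.
apply: le_trans (outer_massS _ _ KV) _; rewrite outer_massE//.
apply: inner_mass_le; first exact: solid_C_c.
  by move=> x; have /andP[] := h01 x.
by move=> x /hV ->.
Qed.

(** The support of a test function [f] is a compact subset of [U] whose mass is already at least
    [r f]. *)
Lemma outer_mass_sup U : open U -> outer_mass U =
  ereal_sup [set outer_mass K | K in [set K | compact K /\ K `<=` U]].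
Proof.
move=> oU; apply/eqP; rewrite eq_le; apply/andP; split; last first.
  by apply: ge_ereal_sup => _ [K [cK KU] <-]; exact: outer_massS.
rewrite outer_massE//; apply: ge_ereal_sup => _ [f bf <-].
have [fC f01 fU] := bf.
apply: (@le_trans _ _ (outer_mass (supp f))); first by apply: subord_outer; split.
by apply: ereal_sup_ubound; exists (supp f) => //; split=> //; exact: subord_compact bf.
Qed.

(** Once [g] subordinate to [V] is fixed, removing [supp g] from [U] leaves an open neighbourhood of
    [A], and a function subordinate to it is disjoint from [g]. The set [A] is arbitrary because the
    Caratheodory condition requires it. *)
Lemma outer_mass_superadd A U V : open U -> open V -> V `<=` U -> A `<=` U ->
  V `&` A = set0 -> outer_mass V + outer_mass A <= outer_mass U.
Proof.
move=> oU oV VU AU VA0.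
have [Aoo|] := boolP (outer_mass A \is a fin_num); last first.
  rewrite ge0_fin_numE ?outer_mass_ge0// -leNgt leye_eq => /eqP Aoo.
  by have := outer_massS _ _ AU; rewrite Aoo leye_eq => /eqP ->; exact: leey.
rewrite -leeBrDr// [leLHS]outer_massE//; apply: ge_ereal_sup => _ [g bg <-].
have [gC g01 gV] := bg.
rewrite leeBrDr// -leeBrDl//.
have oUg : open (U `\` supp g).
  by rewrite setDE; apply: openI => //; apply: closed_openC; exact: closed_supp.
apply: (@le_trans _ _ (outer_mass (U `\` supp g))).
  apply: outer_massS => x Ax; split; first exact: AU.
  by move=> /gV Vx; have : (V `&` A) x by []; rewrite VA0.
rewrite outer_massE//; apply: ge_ereal_sup => _ [f bf <-].
have [fC f01 fU] := bf.
have fg0 x : f x = 0%R \/ g x = 0%R.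
  have [/fU[_ ng]|] := pselect (supp f x); last by move=> /supp_eq0; left.
  by right; exact: supp_eq0.
rewrite leeBrDl// -EFinD addrC -(qlf_disjoint P)//.
- apply: subord_outer; split; first exact: (solid_add _ C_c_solid).
    move=> x; have := f01 x; have := g01 x.
    by case: (fg0 x) => ->; rewrite ?add0r ?addr0.
  apply: (@subset_trans _ (supp f `|` supp g)); last by move=> x [/fU[]|/gV/VU].
  apply: supp_sub; first by apply: closedU; exact: closed_supp.
  move=> x; apply: contraPP => /not_orP[nf ng] /eqP; apply.
  by rewrite (supp_eq0 f)// (supp_eq0 g)// addr0.
- exact: solid_C_c.
- exact: solid_C_c.
- by move=> x; have /andP[] := f01 x.
- by move=> x; have /andP[] := g01 x.
Qed.

Lemma outer_mass_lt A (b : \bar R) : outer_mass A < b ->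
  exists U, [/\ open U, A `<=` U & outer_mass U < b].
Proof.
by move=> /ereal_inf_lt[_ [U [oU AU] <-] Ub]; exists U; rewrite outer_massE.
Qed.

Lemma le_outer_massP (x : \bar R) A (y : \bar R) : 0 <= y ->
  (forall U, open U -> A `<=` U -> x <= y + outer_mass U) ->
  x <= y + outer_mass A.
Proof.
move=> y0 xA; have [->|yfin] := eqVneq y +oo.
  by rewrite addye ?leey// gt_eqF// (lt_le_trans _ (outer_mass_ge0 A)).
have yf : y \is a fin_num by rewrite ge0_fin_numE// ltey.
rewrite -leeBlDl//; apply: le_ereal_inf_tmp => _ [U [oU AU] <-].
by rewrite leeBlDl// -outer_massE//; exact: xA.
Qed.

Lemma outer_massU_open U V : open U -> open V -> U `&` V = set0 ->
  outer_mass (U `|` V) = outer_mass U + outer_mass V.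
Proof.
move=> oU oV UV0; apply/eqP; rewrite eq_le; apply/andP; split; last first.
  by apply: outer_mass_superadd => //; exact: openU.
rewrite [leLHS]outer_massE; last exact: openU.
apply: ge_ereal_sup => _ [f bf <-].
have [f1 [f2 [b1 b2 ->]]] := subord_split hX lcX _ _ _ oU oV bf.
have [C1 p1 s1] := b1; have [C2 p2 s2] := b2.
rewrite (qlf_disjoint P)//.
- by rewrite EFinD; apply: leeD; exact: subord_outer.
- exact: subord_in b1.
- exact: subord_in b2.
- by move=> x; have /andP[] := p1 x.
- by move=> x; have /andP[] := p2 x.
- move=> x; have [/s1 Ux|/supp_eq0] := pselect (supp f1 x); last by left.
  right; apply: supp_eq0 => /s2 Vx.
  by have : (U `&` V) x by []; rewrite UV0.
Qed.

(* For [<=], [f] is raised to some [g] equal to 1 near [K]; then a test function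
   [h] around [K], supported where [g = 1], splits off additively. *)
Lemma outer_massD_compact U K : open U -> compact K -> K `<=` U ->
  outer_mass U = outer_mass (U `\` K) + outer_mass K.
Proof.
move=> oU cK KU; have clK : closed K by exact: compact_closed.
have oUK : open (U `\` K) by rewrite setDE; apply: openI => //; exact: closed_openC.
apply/eqP; rewrite eq_le; apply/andP; split; last first.
  apply: outer_mass_superadd => //.
  by rewrite -subset0 => x [[_ nx] Kx]; apply: nx.
apply: le_outer_massP; first exact: outer_mass_ge0.
move=> W oW KW; rewrite [leLHS]outer_massE//; apply: ge_ereal_sup => _ [f bf <-].
have [h1 [h1C h1U h1_01 [N1 [oN1 KN1 h1N1]]]] := urysohn_lc (R := R) hX lcX _ _ cK oU KU.
have bg : subord U (fun x => Num.max (f x) (h1 x)) by apply: subord_max.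
have KN1W : K `<=` N1 `&` W by move=> x Kx; split; [exact: KN1|exact: KW].
have [h [hC hU h01 [N [oN KN hN]]]] :=
  urysohn_lc (R := R) hX lcX _ _ cK (openI oN1 oW) KN1W.
move: bg; set g := (fun x => _) => bg; have [gC g01 gU] := bg.
have gN1 x : N1 x -> g x = 1%R.
  move=> N1x; rewrite /g h1N1// max_r//.
  by have [_ /(_ x)/andP[]] := bf.
have rg : r (fun x => g x - h x)%R = (r g - r h)%R.
  apply: (qlf_stacked P sP r qr h g 1%R) => //.
  - exact: solid_C_c.
  - exact: solid_C_c.
  - by move=> x; have /andP[] := h01 x.
  - by move=> x; have /andP[] := g01 x.
  - move=> x; have [/hU[N1x _]|/supp_eq0] := pselect (supp h x); last by left.
    by right; exact: gN1.
apply: (@le_trans _ _ (r g)%:E).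
  rewrite lee_fin; apply: (qlf_le P) => //.
  - exact: subord_in bf.
  - exact: solid_C_c.
  - by move=> x; have [_ /(_ x)/andP[]] := bf.
  - by move=> x; rewrite /g le_max lexx.
have -> : r g = (r (fun x => g x - h x) + r h)%R by rewrite rg subrK.
rewrite EFinD; apply: leeD; apply: subord_outer.
  have gh x : (0 <= h x <= g x)%R.
    have /andP[h0 h1'] := h01 x; rewrite h0/=.
    have [/hU[N1x _]|/supp_eq0->] := pselect (supp h x); first by rewrite gN1.
    by have /andP[] := g01 x.
  have cgh : continuous (fun x => g x - h x)%R.
    by apply: continuous_subf; [exact: subord_cont bg|case/asboolP: hC].
  have [|ghC gh01 _] := subord_le _ _ _ bg cgh.
    move=> x; have := gh x; have := h01 x; move=> /andP[? ?] /andP[? ?].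
    by apply/andP; split; lra.
  split => //; apply: (@subset_trans _ (supp g `\` N)).
    apply: supp_sub.
      by rewrite setDE; apply: closedI; [exact: closed_supp|exact: open_closedC].
    move=> x ghx; split.
      apply: supp_neq0; apply: contraNneq ghx => gx.
      by have := gh x; rewrite gx => h0; apply/eqP; move/andP: h0 => [? ?]; lra.
    move=> Nx; move: ghx; rewrite hN// gN1 ?subrr ?eqxx//.
    by have /hU[] : supp h x by apply: supp_neq0; rewrite hN// oner_eq0.
  by move=> x [/gU Ux nNx]; split => // /KN.
by split => //; apply: (subset_trans hU) => x [].
Qed.

(** For [<=], [K] and [L] are replaced one at a time by open neighbourhoods, which are then shrunk
    into the disjoint open sets [N] and the complement of [supp h]. *)
Lemma outer_massU_compact K L : compact K -> compact L -> K `&` L = set0 ->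
  outer_mass (K `|` L) = outer_mass K + outer_mass L.
Proof.
move=> cK cL KL0; have clL : closed L by exact: compact_closed.
have KnL : K `<=` ~` L by move=> x Kx Lx; have : (K `&` L) x by []; rewrite KL0.
apply/eqP; rewrite eq_le; apply/andP; split; last first.
  apply: le_ereal_inf_tmp => _ [W [oW KLW] <-].
  have oWL : open (W `\` L) by rewrite setDE; apply: openI => //; exact: closed_openC.
  rewrite -outer_massE//; apply: (@le_trans _ _ (outer_mass (W `\` L) + outer_mass L)).
    by rewrite leeD2r//; apply: outer_massS => x Kx; split; [apply: KLW; left|exact: KnL].
  apply: outer_mass_superadd => //.
  - by move=> x Lx; apply: KLW; right.
  - by rewrite -subset0 => x [[_ nx] /nx].
have [h [hC hU h01 [N [oN KN hN]]]] :=
  urysohn_lc (R := R) hX lcX _ _ cK (closed_openC clL) KnL.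
apply: le_outer_massP; first exact: outer_mass_ge0.
move=> V oV LV; rewrite addeC.
apply: le_outer_massP; first exact: outer_mass_ge0.
move=> U oU KU; rewrite addeC.
have oV' : open (V `\` supp h).
  by rewrite setDE; apply: openI => //; apply: closed_openC; exact: closed_supp.
have oU' : open (U `&` N) by exact: openI.
apply: (@le_trans _ _ (outer_mass ((U `&` N) `|` (V `\` supp h)))).
  apply: outer_massS => x [Kx|Lx]; [left|right]; split.
  - exact: KU.
  - exact: KN.
  - exact: LV.
  - by move=> /hU.
rewrite outer_massU_open//.
  by apply: leeD; apply: outer_massS => x [].
rewrite -subset0 => x [[_ Nx] [_]]; apply.
by apply: supp_neq0; rewrite hN// oner_eq0.
Qed.

(* For [<=], [k] is 1 on [V], which carries the support of [k - h], so [h] and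
   [k - h] add up. *)
Lemma outer_massU_open_compact V K : open V -> compact K -> V `&` K = set0 ->
  compact (V `|` K) -> outer_mass (V `|` K) = outer_mass V + outer_mass K.
Proof.
move=> oV cK VK0 cC; apply/eqP; rewrite eq_le; apply/andP; split; last first.
  apply: le_ereal_inf_tmp => _ [W [oW CW] <-].
  rewrite -outer_massE//; apply: outer_mass_superadd => //.
    by move=> x Vx; apply: CW; left.
  by move=> x Kx; apply: CW; right.
apply: le_outer_massP; first exact: outer_mass_ge0.
move=> W oW KW.
have [h [hC hW h01 [N [oN KN hN]]]] := urysohn_lc (R := R) hX lcX _ _ cK oW KW.
(* The compactness of the union enters here: what [N] leaves of it is a compact part of [V], so one
   function can be 1 there and supported in [V]. *)
have cD : compact ((V `|` K) `\` N).
  apply: (subclosed_compact _ cC); last by move=> x [].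
  rewrite setDE; apply: closedI; last exact: open_closedC.
  exact: compact_closed.
have [|g [gC gV g01 [M [oM DM gM]]]] := urysohn_lc (R := R) hX lcX _ _ cD oV.
  by move=> x [[//|/KN]].
have bgm : subord (W `|` V) (fun x => Num.max (g x) (h x)).
  by apply: subord_max; split => // x; [move/gV; right|move/hW; left].
move: bgm; set k := (fun x => _) => bk; have [kC k01 ks] := bk.
have kVN x : (V `|` N `|` M) x -> k x = 1%R.
  have /andP[? g1] := g01 x; have /andP[? h1] := h01 x.
  move=> [[Vx|Nx]|Mx]; last by rewrite /k gM// max_l.
    have [Nx|nNx] := pselect (N x); first by rewrite /k hN// max_r.
    by rewrite /k gM ?max_l//; apply: DM; split=> //; left.
  by rewrite /k hN// max_r.
have kh x : (0 <= h x <= k x)%R.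
  by have /andP[-> _] := h01 x; rewrite /k le_max lexx orbT.
have ck := subord_cont _ _ bk; have ch : continuous h by case/asboolP: hC.
have bkh : subord V (fun x => k x - h x)%R.
  apply: (subord_le V g) => //; first exact: continuous_subf.
  move=> x; have /andP[h0 h1] := kh x; have /andP[g0 g1] := g01 x.
  rewrite subr_ge0 h1/= /k lerBlDr ge_max; apply/andP; split; lra.
have [khC kh01 khV] := bkh.
have rk : r h = (r k - r (fun x => k x - h x))%R.
  rewrite -(qlf_stacked P sP r qr (fun x => k x - h x)%R k 1%R)//.
  - by congr r; apply/funext => x; rewrite subKr.
  - exact: solid_C_c.
  - exact: solid_C_c.
  - by move=> x; have /andP[] := kh01 x.
  - by move=> x; have /andP[] := k01 x.
  - move=> x; have [/khV Vx|/supp_eq0] := pselect (supp (fun x => k x - h x)%R x); last by left.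
    by right; apply: kVN; left; left.
apply: (@le_trans _ _ (r k)%:E).
  apply: (@le_trans _ _ (outer_mass (V `|` N))).
    by apply: outer_massS => x [Vx|/KN]; [left|right].
  rewrite outer_massE; last exact: openU.
  apply: inner_mass_le; first exact: solid_C_c.
    by move=> x; have /andP[] := k01 x.
  by move=> x VNx; rewrite kVN//; left.
have -> : r k = (r (fun x => k x - h x) + r h)%R by rewrite rk; lra.
rewrite EFinD; apply: leeD; apply: subord_outer => //.
Qed.

End one_functional.
End set_function.

(** * Comparison of two functionals through their masses of open sets *)

Section comparison.
Context {R : realType} {X : topologicalType}.
Variable P : {pred X -> R}.
Hypothesis sP : solid_space P.
Variables r s : (X -> R) -> R.
Hypotheses (qr : qlf P r) (qs : qlf P s).
Hypothesis tr : small_tails P r.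
Hypothesis ts : small_tails P s.
Hypothesis rs : forall U, open U -> (inner_mass r U <= inner_mass s U)%E.
Implicit Types f : X -> R.

(** Both sides are compared with [e] times the mass of [U], the set where [f > e]. The upper layer
    starts at [2 e] because its support is closed and has to fit, compactly, inside the open [U];
    starting at [e] would only place it where [f >= e]. *)
Lemma layer_comparison f e : 0 < e -> f \in P -> (forall x, 0 <= f x) ->
  r (trunc (excess f (2 * e)) e) <= s (trunc f e).
Proof.
move=> e0 fP f0; have e0' := ltW e0.
have cf := solid_cont _ sP _ fP.
have e20 : 0 <= 2 * e by lra.
have gP : trunc (excess f (2 * e)) e \in P.
  by apply: solid_trunc => //; apply: solid_excess.
have hP : trunc f e \in P by exact: solid_trunc.
pose U := [set x | e < f x].
have cgP : (fun x => e^-1 * trunc (excess f (2 * e)) e x) \in P.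
  exact: solid_scale.
have bg : subord U (fun x => e^-1 * trunc (excess f (2 * e)) e x).
  have sg : supp (fun x => e^-1 * trunc (excess f (2 * e)) e x)
      `<=` [set x | 2 * e <= f x].
    apply: supp_sub; first exact: closed_preim_le.
    move=> x; apply: contraNT; rewrite -ltNge => fx.
    by rewrite /trunc excessE (ltW fx) min_l// mulr0.
  split.
  - apply/asboolP; split; first exact: (solid_cont _ sP).
    apply: (subclosed_compact _ _ sg); first exact: closed_supp.
    by apply: C_0_compact_lt; [exact: (solid_C_0 _ sP)|lra].
  - move=> x; rewrite mulr_ge0 ?invr_ge0// ?trunc_ge0//; last exact: excess_ge0.
    by rewrite mulrC ler_pdivrMr// mul1r trunc_le.
  - by apply: (subset_trans sg) => x /= ?; rewrite /U/=; lra.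
have oU : open U by exact: open_preim_lt.
have := subord_inner r _ _ bg; move=> /le_trans/(_ (rs _ oU)).
have chP : (fun x => e^-1 * trunc f e x) \in P by exact: solid_scale.
move=> /le_trans/(_ (inner_mass_le P sP s qs ts U _ chP _ _)).
rewrite (qlf_scale _ _ qr)// (qlf_scale _ _ qs)// lee_fin ler_pM2l ?invr_gt0//.
apply.
- by move=> x; rewrite mulr_ge0 ?invr_ge0// trunc_ge0.
- by move=> x; rewrite /U/= /trunc => efx; rewrite min_r ?mulVf ?gt_eqF// ltW.
Qed.

Lemma excess_comparison n f e : 0 < e -> f \in P -> (forall x, 0 <= f x) ->
  (forall x, f x <= n%:R * e) -> r (excess f (2 * e)) <= s f.
Proof.
move=> e0; have e0' := ltW e0; have e20 : 0 <= 2 * e by lra.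
elim: n f => [|n IH] f fP f0 fn.
  rewrite (_ : excess f _ = fun=> 0) ?(qlf0 P)//; first exact: (qlf_ge0 _ _ qs).
  by apply/funext => x; rewrite excessE ifT//; have := fn x; rewrite mul0r; lra.
have fe : excess f (2 * e) \in P by exact: solid_excess.
rewrite (qlf_trunc P sP r qr (excess f (2 * e)) e)// (qlf_trunc P sP s qs f e)//.
apply: lerD; first exact: layer_comparison.
rewrite excess_comm//; apply: IH; first exact: solid_excess.
  by move=> x; exact: excess_ge0.
move=> x; have := fn x; rewrite excessE -natr1.
have : 0 <= n%:R * e by rewrite mulr_ge0// ler0n.
by have [h|h] := leP (f x) e; lra.
Qed.

Lemma qlf_comparison f : f \in P -> (forall x, 0 <= f x) -> r f <= s f.
Proof.
move=> fP f0; apply: (le_of_small_tails P sP r qr tr f _ 2) => // e e0.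
have [n fn] := bounded_steps P sP f e fP e0.
exact: (excess_comparison n).
Qed.

End comparison.

Lemma qlf_eq {R : realType} {X : topologicalType} (P : {pred X -> R})
    (sP : solid_space P) r s : qlf P r -> qlf P s ->
  small_tails P r -> small_tails P s ->
  (forall U, open U -> inner_mass r U = inner_mass s U) ->
  forall f, f \in P -> r f = s f.
Proof.
move=> qr qs tr ts rs f fP.
have pos g : g \in P -> (forall x, 0 <= g x) -> r g = s g.
  move=> gP g0; apply/eqP; rewrite eq_le; apply/andP; split.
    by apply: (qlf_comparison P) => // U oU; rewrite rs.
  by apply: (qlf_comparison P) => // U oU; rewrite rs.
have nfP : (fun x => - f x) \in P.
  have := solid_scale _ sP (-1) _ fP.
  by congr (_ \in P); apply/funext => x; rewrite mulN1r.
rewrite (qlf_pos_neg P sP r qr)// (qlf_pos_neg P sP s qs)// !pos//.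
- exact: solid_excess.
- by move=> x; exact: excess_ge0.
- exact: solid_excess.
- by move=> x; exact: excess_ge0.
Qed.

(** * From functionals on the subtype to functionals on all functions *)

Section extension.
Context {R : realType} {X : topologicalType}.
Variable P : {pred X -> R}.
Hypothesis sP : solid_space P.
Variable B : subLmodType P.
Implicit Types (rho : B -> R) (f g : X -> R).

(** The default value 0 of [insubd] is reached only outside [P], where [qlf] asserts nothing. *)
Definition extend rho f : R := rho (insubd (0 : B) f).

Lemma extend_val rho (u : B) : extend rho (\val u) = rho u.
Proof. by rewrite /extend valKd. Qed.

Lemma extend_qlf rho : quasi_linear rho -> qlf P (extend rho).
Proof.
move=> [rZ rD r0]; split.
- move=> a f fP; rewrite /extend -rZ; congr rho; apply: val_inj.
  rewrite linearZ/= !insubdK//; exact: (solid_scale _ sP).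
- move=> h f g hP fP gP hf hg; rewrite /extend -rD.
    congr rho; apply: val_inj; rewrite raddfD/= !insubdK//.
    exact: (solid_add _ sP).
  by exists (insubd (0 : B) h); rewrite !insubdK.
- by move=> f fP f0; apply: r0 => x; rewrite insubdK.
Qed.

Lemma quasi_linear_extend rho : qlf P (extend rho) -> quasi_linear rho.
Proof.
move=> [rZ rD r0]; split.
- move=> a f; rewrite -[RHS]/(a * rho f) -(extend_val rho f) -rZ; last exact: valP.
  by rewrite -extend_val linearZ.
- move=> f g [h [hf hg]]; rewrite -!extend_val -(rD (\val h))//; try exact: valP.
  by rewrite raddfD.
- by move=> f f0; rewrite -extend_val; apply: r0 => //; exact: valP.
Qed.

Lemma mu_open_extend rho U : mu_open rho U = inner_mass (extend rho) U.
Proof.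
congr ereal_sup; apply/seteqP; split => _ [f [fC f01 fU] <-].
  by exists (\val f); rewrite ?extend_val.
have fP : f \in P by exact: (solid_C_c _ sP).
by exists (insubd (0 : B) f) => //=; rewrite insubdK.
Qed.

Lemma mu_of_extend rho (A : open_or_closed X) :
  mu_of rho A = outer_mass (extend rho) A.
Proof.
rewrite /mu_of; case: ifPn => [/asboolP oA|_].
  by rewrite outer_massE// mu_open_extend.
by congr ereal_inf; apply/seteqP; split => _ [U [oU AU] <-]; exists U;
  rewrite ?mu_open_extend.
Qed.

Section topological_measure_of_functional.
Hypothesis hX : hausdorff_space X.
Hypothesis lcX : locally_compact [set: X].
Variable rho : B -> R.
Hypothesis qr : quasi_linear rho.
Hypothesis tr : small_tails P (extend rho).
Let qr' := extend_qlf rho qr.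

Definition oc_closed (F : set X) (cF : closed F) : open_or_closed X :=
  OpenOrClosed (or_intror cF).

Lemma mu_of_topological : topological_measure (mu_of rho).
Proof.
(* Two open or two compact sets have a union of the same kind. Only the mixed case depends on what
   the union is; if it is open, it is cut along the compact piece. *)
have main (A B0 : set X) : A `&` B0 = set0 -> open A -> compact B0 ->
    compact (A `|` B0) \/ open (A `|` B0) ->
    outer_mass (extend rho) (A `|` B0) =
    (outer_mass (extend rho) A + outer_mass (extend rho) B0)%E.
  move=> AB0 oA cB [cC|oC]; first exact: (outer_massU_open_compact hX lcX P sP).
  rewrite (outer_massD_compact hX lcX P sP _ qr' tr _ _ oC cB); last by right.
  congr (outer_mass _ _ + _)%E; rewrite setDUl setDv setU0.
  apply/seteqP; split=> [x []//|x Ax]; split=> // Bx.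
  by have : (A `&` B0) x by []; rewrite AB0.
split.
- by move=> A; rewrite mu_of_extend (outer_mass_ge0 P).
- exists (oc_open open0); rewrite mu_of_extend lt_eqF//.
  by apply: (outer_mass_compact hX lcX P sP) => //; exact: compact0.
- move=> A B0 C AB0 CE; rewrite !mu_of_extend CE => -[cA|oA] [cB|oB] hC.
  + exact: (outer_massU_compact hX lcX P sP).
  + by rewrite setUC addeC; apply: main; rewrite 1?setIC 1?setUC.
  + exact: main.
  + exact: (outer_massU_open hX lcX P sP).
- move=> U oU; rewrite mu_of_extend outer_mass_sup//.
  congr ereal_sup; apply/seteqP; split => _ [K [cK KU] <-].
    exists (oc_closed K (compact_closed hX cK)); first by [].
    by rewrite mu_of_extend.
  by exists (K : set X) => //; rewrite mu_of_extend.
- move=> F cF; rewrite mu_of_extend outer_mass_inf.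
  congr ereal_inf; apply/seteqP; split => _ [U [oU FU] <-].
    by exists (oc_open oU); rewrite ?mu_of_extend.
  by exists (U : set X) => //; rewrite mu_of_extend.
Qed.

Lemma mu_of_compact_finite : compact_finite_tm (mu_of rho).
Proof. by move=> K cK; rewrite mu_of_extend (outer_mass_compact hX lcX P). Qed.

End topological_measure_of_functional.
End extension.
Arguments extend {R X P B}.

(** * Distribution of a function under a topological measure *)

Section topological_measure_on_sets.
Context {R : realType} {X : topologicalType}.
Hypothesis hX : hausdorff_space X.
Variable mu : open_or_closed X -> \bar R.
Hypothesis tm : topological_measure mu.
Local Open Scope ereal_scope.
Implicit Types (A U V K : set X).

(** The extension to all subsets removes the packaging of a set with a proof that it is open or
    closed. *)
Definition tm_ext A : \bar R :=
  ereal_inf [set mu U | U in [set U : open_or_closed X | open U /\ A `<=` U]].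

Lemma tm_extE (A : open_or_closed X) : tm_ext A = mu A.
Proof.
have [_ _ _ _ tm3] := tm; case: (ocsetP A) => [oA|cA]; last by rewrite tm3.
apply/eqP; rewrite eq_le; apply/andP; split.
  by apply: ereal_inf_lbound; exists A => //; split.
by apply: le_ereal_inf_tmp => _ [U [oU AU] <-]; exact: tm_open_le.
Qed.

Lemma tm_ext_ge0 A : 0 <= tm_ext A.
Proof. by apply: le_ereal_inf_tmp => _ [U _ <-]; case: tm. Qed.

Lemma tm_extS A B : A `<=` B -> tm_ext A <= tm_ext B.
Proof.
move=> AB; apply: ereal_inf_le_tmp => _ [U [oU BU] <-]; exists U => //; split => //.
exact: subset_trans BU.
Qed.

Lemma tm_ext_sup U : open U ->
  tm_ext U = ereal_sup [set tm_ext K | K in [set K | compact K /\ K `<=` U]].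
Proof.
move=> oU; have [_ _ _ tm2 _] := tm.
rewrite -[U]/(oc_open oU : set X) tm_extE tm2//; congr ereal_sup.
apply/seteqP; split => _ [K [cK KU] <-]; first by exists (K : set X) => //; rewrite tm_extE.
exists (oc_closed K (compact_closed hX cK)) => //.
by rewrite -tm_extE.
Qed.

Lemma tm_ext_inf A : tm_ext A =
  ereal_inf [set tm_ext U | U in [set U | open U /\ A `<=` U]].
Proof.
congr ereal_inf; apply/seteqP; split => _ [U [oU AU] <-].
  by exists (U : set X) => //; rewrite tm_extE.
by exists (oc_open oU) => //; rewrite -tm_extE.
Qed.

Lemma tm_extU U V : open U -> open V -> U `&` V = set0 ->
  tm_ext (U `|` V) = tm_ext U + tm_ext V.
Proof.
move=> oU oV UV0; have [_ _ tm1 _ _] := tm.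
have := tm1 (oc_open oU) (oc_open oV) (oc_open (openU oU oV)) UV0 erefl.
rewrite -!tm_extE; apply; right => /=; [exact: oU|exact: oV|exact: openU].
Qed.

Lemma tm_extD U K : open U -> compact K -> K `<=` U ->
  tm_ext U = tm_ext (U `\` K) + tm_ext K.
Proof.
move=> oU cK KU; have [_ _ tm1 _ _] := tm.
have clK : closed K by exact: compact_closed.
have oUK : open (U `\` K) by rewrite setDE; apply: openI => //; exact: closed_openC.
have := tm1 (oc_open oUK) (oc_closed K clK) (oc_open oU).
rewrite -!tm_extE; apply => /=; [| |by right; exact: oUK|by left|by right; exact: oU].
  by rewrite -subset0 => x [[_ nK] Kx]; apply: nK.
by rewrite setUC setDUK.
Qed.

Lemma tm_ext0 : tm_ext set0 = 0.
Proof.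
have [_ [A Aoo] _ _ _] := tm.
have [U [oU Uoo]] : exists U : set X, open U /\ tm_ext U < +oo.
  have : mu A < +oo by rewrite ltey.
  rewrite -tm_extE => /ereal_inf_lt[_ [U [oU _] <-] Uoo].
  by exists (U : set X); rewrite tm_extE.
have := tm_extU _ _ oU open0 (setI0 U); rewrite setU0 => /eqP.
rewrite addeC -[X in X == _]add0e eq_sym.
have Uf : tm_ext U \is a fin_num by rewrite ge0_fin_numE// tm_ext_ge0.
have sf : tm_ext set0 \is a fin_num.
  by rewrite ge0_fin_numE ?tm_ext_ge0// (le_lt_trans (tm_extS _ U _)).
rewrite -(fineK Uf) -(fineK sf) -!EFinD => /eqP[] h; congr EFin; lra.
Qed.

Lemma tm_ext_bigsetU (U : nat -> set X) n : (forall i, open (U i)) ->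
  trivIset setT U ->
  tm_ext (\bigcup_(i < n) U i) = \sum_(0 <= i < n) tm_ext (U i).
Proof.
move=> oU tU; elim: n => [|n IH].
  rewrite big_geq// bigcup0 ?tm_ext0// => i; by rewrite /= ltn0.
rewrite big_nat_recr//= -IH -tm_extU//.
- congr tm_ext; rewrite bigcup_mkord big_ord_recr/= -bigcup_mkord//.
- by apply: bigcup_open => i _.
- rewrite -subset0 => x [[i /= ni Uix] Unx].
  by have := tU i n I I; move=> /(_ (ex_intro _ x (conj Uix Unx))) ein; rewrite ein ltnn in ni.
Qed.

(** Countable additivity on open sets comes from inner regularity: a compact subset of the union
    lies in finitely many of the [U i]. *)
Lemma tm_ext_bigcup (U : nat -> set X) : (forall i, open (U i)) ->
  trivIset setT U -> tm_ext (\bigcup_i U i) = \sum_(0 <= i <oo) tm_ext (U i).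
Proof.
move=> oU tU; apply/eqP; rewrite eq_le; apply/andP; split; last first.
  apply: lime_le; first by apply: is_cvg_nneseries => n _ _; exact: tm_ext_ge0.
  apply: nearW => n; rewrite -tm_ext_bigsetU//; apply: tm_extS.
  by move=> x [i _ Uix]; exists i.
rewrite tm_ext_sup; last by apply: bigcup_open => i _.
apply: ge_ereal_sup => _ [K [cK KU] <-].
have [n Kn] : exists n, K `<=` \bigcup_(i < n) U i.
  have /compact_near_coveringP/(_ nat \oo (fun n x => (\bigcup_(i < n) U i) x)) := cK.
  move=> /(_ _ _)[|n _ /(_ n (leqnn n))]; last by move=> h; exists n.
  move=> x /KU[i _ Uix].
  exists (U i, [set n | (i < n)%N]) => /=.
    by split; [exact: open_nbhs_nbhs|exists i.+1].
  by move=> [y n] [/= Uiy ni]; exists i.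
apply: le_trans (tm_extS _ _ Kn) _; rewrite tm_ext_bigsetU//.
by apply: nneseries_lim_ge => // i *; exact: tm_ext_ge0.
Qed.

End topological_measure_on_sets.

(** * Exhausting an open interval of the line *)

Section cofinal.
Context {R : realType}.
Implicit Types I : set R.

(** Serves, with the coinitial version, to exhaust an open interval by half-open ones, on which the
    Stieltjes measure is known outright. A finite supremum is approached by
    [sup I - (sup I - p) / (n + 1)], an infinite one by [p + n]. *)
Lemma cofinal_seq I : open I -> is_interval I -> I !=set0 ->
  exists c : nat -> R, [/\ forall n, I (c n), {homo c : m n / (m <= n)%N >-> m <= n} &
    forall x, I x -> exists n, x <= c n].
Proof.
move=> oI iI [p Ip].
have above x : I x -> exists2 y, I y & x < y.
  move=> Ix; have : nbhs x^'+ I.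
    by apply: cvg_within; apply: open_nbhs_nbhs.
  move=> h; near x^'+ => y; exists y; near: y; [exact: h|exact: nbhs_right_gt].
have [supI|nsupI] := pselect (has_sup I); last first.
  exists (fun n => p + n%:R); split.
  - move=> n; have : ~ has_ubound I by move=> h; apply: nsupI; split => //; exists p.
    move=> /has_ubPn/(_ (p + n%:R))[y Iy py].
    by apply: (iI p y) => //; rewrite lerDl ler0n ltW.
  - by move=> m n mn; rewrite lerD2l ler_nat.
  - move=> x Ix; exists (Num.truncn (x - p)).+1.
    by rewrite -lerBlDl; exact/ltW/truncnS_gt.
have supgt x : I x -> x < sup I.
  by move=> /above[y Iy xy]; apply: lt_le_trans xy _; exact: sup_upper_bound.
have ps := supgt _ Ip.
have d0 : 0 < sup I - p by rewrite subr_gt0.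
pose c n := sup I - (sup I - p) / n.+1%:R.
have cs n : c n < sup I by rewrite /c ltrBlDr ltrDl divr_gt0.
exists c; split.
- move=> n; have e0 : 0 < sup I - c n by rewrite subr_gt0.
  have [y Iy] := sup_adherent e0 supI; rewrite subKr => cy.
  apply: (iI p y) => //; rewrite (ltW cy) andbT /c.
  rewrite lerBrDr -lerBrDl ler_pdivrMr// ler_peMr ?(ltW d0)//.
  by rewrite ler1n.
- move=> m n mn; rewrite /c lerD2l lerN2 ler_pM2l// lef_pV2 ?posrE//.
  by rewrite ler_nat.
- move=> x Ix; have e0 : 0 < sup I - x by rewrite subr_gt0 supgt.
  exists (Num.truncn ((sup I - p) / (sup I - x))).
  rewrite /c lerBrDr addrC -lerBrDr ler_pdivrMr// mulrC -ler_pdivrMr//.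
  exact/ltW/truncnS_gt.
Unshelve. all: by end_near. Qed.

(** By reflection. The inequality is strict because the intervals to be formed exclude their left
    ends. *)
Lemma coinitial_seq I : open I -> is_interval I -> I !=set0 ->
  exists a : nat -> R, [/\ forall n, I (a n), {homo a : m n / (m <= n)%N >-> n <= m} &
    forall x, I x -> exists n, a n < x].
Proof.
move=> oI iI I0; pose J := [set x | I (- x)].
have oJ : open J.
  by apply: (@open_comp _ _ (-%R) I) => // x _; exact: opp_continuous.
have iJ : is_interval J.
  move=> x y Jx Jy z /andP[xz zy]; apply: (iI (- y) (- x)) => //.
  by rewrite !lerN2 zy.
have [|c [Jc cm cc]] := cofinal_seq J oJ iJ.
  by case: I0 => x Ix; exists (- x); rewrite /J/= opprK.
exists (fun n => - c n); split => //; first by move=> m n mn; rewrite lerN2 cm.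
move=> x Ix; have [y Jy xy] : exists2 y, J y & - x < y.
  have h : nbhs (- x)^'+ J.
    by apply: cvg_within; apply: open_nbhs_nbhs; split => //; rewrite /J/= opprK.
  near (- x)^'+ => y; exists y; near: y; [exact: h|exact: nbhs_right_gt].
have [n yc] := cc y Jy; exists n; rewrite ltrNl; exact: lt_le_trans yc.
Unshelve. all: by end_near. Qed.

End cofinal.

(** * Measures on the line that represent a function *)

Section representing_measures.
Context {R : realType} {X : topologicalType}.
Hypothesis hX : hausdorff_space X.
Variable mu : open_or_closed X -> \bar R.
Hypothesis tm : topological_measure mu.
Implicit Types (nu : {measure set (measurableTypeR R) -> \bar R}) (h f : X -> R).

(* Nothing is required of [nu] at [0], where the two versions of the tail
   function in the definition of [rho_mu] differ. *)
Definition represents nu h := forall W : set R, open W -> ~ W 0 ->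
  nu W = tm_ext mu (h @^-1` W).

Lemma open_measurableTypeR (W : set R) : open W ->
  measurable (W : set (measurableTypeR R)).
Proof. exact: open_measurable. Qed.

Section from_half_open_intervals.
Variable nu : {measure set (measurableTypeR R) -> \bar R}.
Variable h : X -> R.
Hypothesis hC : h \in @C_0_pred R X.
Hypothesis nuE : forall a c : R, a < c -> 0 <= a \/ c < 0 ->
  nu `]a, c]%classic =
  (tm_ext mu [set x | (a < h x < c)%R] + tm_ext mu [set x | h x = c])%E.
Let ch : continuous h. Proof. by case/asboolP: hC. Qed.

Lemma C_0_compact_level (c : R) : c != 0 -> compact [set x | h x = c].
Proof.
move=> c0; have /asboolP[_ /(_ `|c|)] := hC.
rewrite normr_gt0 => /(_ c0) cK; apply: (subclosed_compact _ cK).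
  by apply: (@preimage_closed _ _ h [set c]) => //; exact: closed_eq.
by move=> x /= ->.
Qed.

Lemma open_between (a c : R) : open [set x | (a < h x < c)%R].
Proof.
rewrite (_ : [set x | _] = [set x | a < h x] `&` [set x | h x < c]).
  by apply: openI; [exact: open_preim_lt|exact: open_preim_gt].
by apply/seteqP; split=> x /=; [move=> /andP[]|move=> [-> ->]].
Qed.

(** An open interval missing 0 lies on one side of it, so [nuE] applies to its half-open
    subintervals. For [<=], the level set at the right end is compact and disjoint from the open
    part, so their masses add up inside the preimage of [I]. For [>=], [h] attains its bounds on a
    compact set. *)
Lemma represents_interval (I : set R) : open I -> is_interval I -> ~ I 0 ->
  nu I = tm_ext mu (h @^-1` I).
Proof.
move=> oI iI nI0.
have sgnI a c : I a -> I c -> a < c -> 0 <= a \/ c < 0.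
  move=> Ia Ic ac; have [|a0] := leP 0 a; first by left.
  have [c0|] := leP 0 c; last by right.
  by exfalso; apply: nI0; apply: (iI a c) => //; rewrite (ltW a0).
have oJ : open (h @^-1` I) by apply: open_comp => // x _; exact: ch.
have mI : measurable (I : set (measurableTypeR R)).
  exact: open_measurableTypeR.
have subI a c : I a -> I c -> `]a, c]%classic `<=` I.
  move=> Ia Ic x /=; rewrite in_itv/= => /andP[ax xc].
  by apply: (iI a c) => //; rewrite (ltW ax).
have sub2 a c : I a -> I c -> [set x | (a < h x < c)%R] `<=` h @^-1` I.
  by move=> Ia Ic x /= /andP[ax xc]; apply: (iI a c) => //; rewrite !ltW.
have [I0|/set0P/negP/negPn/eqP ->] := pselect (I !=set0); last first.
  by rewrite measure0 preimage_set0 tm_ext0.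
have [a [Ia adec aI]] := coinitial_seq I oI iI I0.
have [c [Ic cinc cI]] := cofinal_seq I oI iI I0.
apply/eqP; rewrite eq_le; apply/andP; split; last first.
  rewrite (tm_ext_sup hX)//; apply: ge_ereal_sup => _ [K [cK KI] <-].
  have [K0|K0] := pselect (K !=set0); last first.
    have -> : K = set0 by apply/eqP/negPn/negP => /set0P.
    by rewrite tm_ext0// measure_ge0.
  have chK : {within K, continuous h} by exact: continuous_subspaceT.
  have [x1 + hx1] := compact_EVT_min K0 cK chK; rewrite inE => Kx1.
  have [x2 + hx2] := compact_EVT_max K0 cK chK; rewrite inE => Kx2.
  have [n an] := aI _ (KI _ Kx1).
  have [y Iy yx2] : exists2 y, I y & h x2 < y.
    have hI : nbhs (h x2)^'+ I.
      by apply: cvg_within; apply: open_nbhs_nbhs; split => //; exact: KI.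
    near (h x2)^'+ => y; exists y; near: y; [exact: hI|exact: nbhs_right_gt].
  have ay : a n < y.
    by apply: lt_trans yx2; apply: lt_le_trans an _; apply: hx2; rewrite inE.
  apply: (@le_trans _ _ (tm_ext mu [set x | (a n < h x < y)%R])).
    apply: tm_extS => x Kx /=; apply/andP; split.
      by apply: lt_le_trans an _; apply: hx1; rewrite inE.
    by apply: le_lt_trans yx2; apply: hx2; rewrite inE.
  apply: (@le_trans _ _ (nu `]a n, y]%classic)).
    by rewrite nuE ?leeDl ?tm_ext_ge0//; exact: sgnI.
  by apply: le_measure; rewrite ?inE; [exact: measurable_itv|exact: mI|exact: subI].
pose F n : set (measurableTypeR R) := `]a n, c n]%classic.
have FI : \bigcup_n F n = I.
  apply/seteqP; split=> [x [n _]|x Ix]; first exact: subI.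
  have [n an] := aI x Ix; have [m cm] := cI x Ix.
  exists (maxn n m) => //; rewrite /F/= in_itv/=; apply/andP; split.
    by apply: le_lt_trans an; apply: adec; exact: leq_maxl.
  by apply: le_trans cm _; apply: cinc; exact: leq_maxr.
have mF n : measurable (F n) by exact: measurable_itv.
have ndF : nondecreasing_seq F.
  move=> n m nm; apply/subsetPset => x; rewrite /F/= !in_itv/= => /andP[ax xc].
  by rewrite (le_lt_trans _ ax) ?adec//= (le_trans xc)// cinc.
have := @nondecreasing_cvg_mu _ _ _ nu F mF; rewrite FI => /(_ mI ndF) cvgF.
rewrite -(cvg_lim _ cvgF)//; apply: lime_le.
  by apply/cvg_ex; eexists; exact: cvgF.
apply: nearW => n /=; have [ac|ca] := ltP (a n) (c n); last first.
  by rewrite /F set_itv_ge ?measure0 ?tm_ext_ge0// -leNgt.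
have [m0|m0] := pselect (c n = 0); first by exfalso; apply: nI0; rewrite -m0.
rewrite /F nuE//; last exact: sgnI.
have cL : compact [set x | h x = c n] by apply: C_0_compact_level; apply/eqP.
rewrite (tm_extD hX mu tm _ _ oJ cL); last by move=> x /= ->.
by rewrite leeD2r//; apply: tm_extS => x /= /andP[ax xc]; split;
  [apply: (sub2 _ _ (Ia n) (Ic n)); rewrite /= ax xc|apply/eqP; rewrite lt_eqF].
Unshelve. all: by end_near. Qed.

Lemma represents_half_open : represents nu h.
Proof.
move=> W oW nW0; have tI := @open_disjoint_itv_trivIset R W oW.
have oI := @open_disjoint_itv_open R W oW.
have nI i : ~ open_disjoint_itv oW i 0.
  by move=> Ii; apply: nW0; rewrite (open_disjoint_itv_bigcup oW); exists i.
have mI i : measurable (open_disjoint_itv oW i : set (measurableTypeR R)).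
  exact: open_measurableTypeR.
rewrite {1 2}(open_disjoint_itv_bigcup oW) preimage_bigcup.
rewrite (tm_ext_bigcup hX)//.
- rewrite measure_semi_bigcup//; last exact: bigcupT_measurable.
  apply: eq_eseriesr => i _; apply: represents_interval => //.
  exact: open_disjoint_itv_is_interval.
- by move=> i; apply: open_comp => // x _; exact: ch.
- by move=> i j _ _ [x [Ii Ij]]; apply: tI => //; exists (h x).
Qed.

End from_half_open_intervals.

Section from_tails.
Variable h : X -> R.
Hypothesis hC : h \in @C_0_pred R X.
Variable E : set X.
Hypothesis oE : open E.
Hypothesis hE : forall x, h x != 0 -> E x.
Hypothesis Eoo : (tm_ext mu E < +oo)%E.
Let V a := [set x | a < h x] `&` E.
Let F a := fine (tm_ext mu (V a)).
Variable nu : {measure set (measurableTypeR R) -> \bar R}.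
Hypothesis nuF : forall s t, s < t -> nu `]s, t]%classic = (F s - F t)%:E.
Let ch : continuous h. Proof. by case/asboolP: hC. Qed.

Let Vfin a : tm_ext mu (V a) \is a fin_num.
Proof.
by rewrite ge0_fin_numE ?tm_ext_ge0// (le_lt_trans (tm_extS _ _ E _))// => x [].
Qed.

(** [E] is the whole space for the tails of case (A) and the set where [h != 0] for those of case
    (B). Either way, removing from [V a] the compact level set at [c] leaves two disjoint open sets,
    the one where [a < h < c] and [V c]. *)
Lemma represents_tails : represents nu h.
Proof.
apply: represents_half_open => // a c ac ac0; rewrite nuF//.
have oV b : open (V b) by apply: openI => //; exact: open_preim_lt.
have [c0|c0] := eqVneq c 0; first by exfalso; case: ac0; lra.
have cL : compact [set x | h x = c] by exact: C_0_compact_level.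
have VaE : V a `\` [set x | h x = c] = [set x | (a < h x < c)%R] `|` V c.
  apply/seteqP; split=> x /=.
    move=> [[ax Ex] xc]; have [xc'|xc'] := ltP (h x) c; first by left; rewrite ax.
    by right; split => //=; rewrite lt_neqAle xc' andbT eq_sym; exact/eqP.
  move=> [/andP[ax xc]|[cx Ex]].
    split; last by move=> /= hxc; move: xc; rewrite hxc ltxx.
    split => //; apply: hE; apply/negP => /eqP hx0.
    by move: ax xc; rewrite hx0; case: ac0; lra.
  split; last by move=> /= hxc; move: cx; rewrite /= hxc ltxx.
  by split => //=; exact: lt_trans cx.
have LV : [set x | h x = c] `<=` V a.
  by move=> x /= hxc; split; rewrite /= ?hxc//; apply: hE; rewrite hxc.
have Va := tm_extD hX mu tm _ _ (oV a) cL LV; rewrite VaE in Va.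
rewrite tm_extU// in Va; last 2 first.
- exact: open_between.
- by rewrite -subset0 => x [/= /andP[_ xc] [/= cx _]]; move: (lt_trans xc cx); rewrite ltxx.
by rewrite EFinB !fineK// Va addeAC addeK.
Qed.

Lemma tails_finite : (nu setT < +oo)%E.
Proof.
apply: le_lt_trans Eoo.
pose G n : set (measurableTypeR R) := `](- n%:R)%R, n%:R]%classic.
have GT : \bigcup_n G n = setT.
  by rewrite -(@bigcup_itvT R false false); apply: eq_bigcupr.
have mG n : measurable (G n) by exact: measurable_itv.
have ndG : nondecreasing_seq G.
  move=> n m nm; apply/subsetPset => x; rewrite /G/= !in_itv/= => /andP[ax xc].
  have nm' : n%:R <= m%:R :> R by rewrite ler_nat.
  by apply/andP; split; lra.
have := @nondecreasing_cvg_mu _ _ _ nu G mG; rewrite GT => /(_ measurableT ndG) cvgG.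
rewrite -(cvg_lim _ cvgG)//; apply: lime_le.
  by apply/cvg_ex; eexists; exact: cvgG.
apply: nearW => n /=; have [n0|n0] := eqVneq n 0%N.
  by rewrite /G n0 oppr0 set_itv_ge ?measure0 ?tm_ext_ge0// bnd_simp ltxx.
rewrite /G nuF; last first.
  have : 0 < n%:R :> R by rewrite ltr0n lt0n.
  lra.
apply: (@le_trans _ _ (F (- n%:R))%:E).
  by rewrite lee_fin lerBlDr lerDl; apply: fine_ge0; exact: tm_ext_ge0.
by rewrite fineK//; apply: tm_extS => x [].
Qed.

End from_tails.
End representing_measures.

(** * Integration against representing measures *)

Section integrals.
Context {R : realType}.

Lemma bounded_integrable {d} {T : measurableType d}
    (nu : {measure set T -> \bar R}) (phi : T -> R) (M : R) :
  (nu setT < +oo)%E -> measurable_fun setT phi -> (forall x, `|phi x| <= M) ->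
  nu.-integrable setT (EFin \o phi).
Proof.
move=> nuoo mphi phiM; apply: measurable_bounded_integrable => //.
exists M; split; first exact: num_real.
by move=> N MN x _ /=; rewrite (le_trans (phiM x))// ltW.
Qed.

Lemma pushforward_id {d} {T : measurableType d}
    (nu : {measure set T -> \bar R}) (phi : T -> R) (M : R) :
  (nu setT < +oo)%E -> measurable_fun setT phi -> (forall x, `|phi x| <= M) ->
  exists p : {measure set (measurableTypeR R) -> \bar R},
    (forall A, p A = nu (phi @^-1` A)) /\
    \int[p]_(t in [set: R]) t = \int[nu]_(x in setT) phi x.
Proof.
move=> nuoo mphi phiM.
pose p : {measure set (measurableTypeR R) -> \bar R} :=
  pushforward nu (phi : T -> measurableTypeR R).
exists (p mphi); split => //; rewrite /Rintegral; congr fine.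
rewrite (@integral_pushforward _ _ _ (measurableTypeR R) _ _ mphi nu setT EFin)//.
by rewrite preimage_setT; exact: bounded_integrable phiM.
Qed.

Lemma finite_measure_eq (m1 m2 : {measure set (measurableTypeR R) -> \bar R}) :
  (m1 setT < +oo)%E -> (forall W : set R, open W -> m1 W = m2 W) ->
  forall A, measurable A -> m1 A = m2 A.
Proof.
move=> m1oo m12; apply: (@measure_unique _ _ (measurableTypeR R)
    [set A : set R | open A] (fun=> setT)) => //.
- apply/seteqP; split.
    rewrite [X in X `<=` _](_ : _ = <<s @RGenOpens.G R >>); last first.
      exact: RGenOpens.measurableE.
    by apply: sub_sigma_algebra2 => _ [x [y ->]] /=; exact: interval_open.
  apply: smallest_sub; first exact: sigma_algebra_measurable.
  exact: open_measurable.
- by move=> A B oA oB; exact: openI.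
- by move=> _; exact: openT.
- by rewrite bigcup_const//; exists 0%N.
Qed.

End integrals.

Section integral_representation.
Context {R : realType} {X : topologicalType}.
Hypothesis hX : hausdorff_space X.
Variable mu : open_or_closed X -> \bar R.
Hypothesis tm : topological_measure mu.
Implicit Types (nu : {measure set (measurableTypeR R) -> \bar R}) (h f g : X -> R).

(** The integrand vanishes at 0, so both integrals may be taken over the complement of 0; there the
    two measures agree on open sets, and finiteness makes them equal. *)
Lemma represents_integral_eq nu1 nu2 f :
  (nu1 setT < +oo)%E -> represents mu nu1 f -> represents mu nu2 f ->
  \int[nu1]_(t in [set: R]) t = \int[nu2]_(t in [set: R]) t.
Proof.
move=> nu1oo r1 r2.
have mD : measurable (~` [set 0] : set (measurableTypeR R)).
  by apply: measurableC; exact: measurable_set1.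
have D0 : (@id R) \_ (~` [set 0]) = id.
  apply/funext => t; rewrite patchE; case: ifPn => //; rewrite notin_setE /= => /contrapT.
  by move=> ->.
have E nu : \int[nu]_(t in [set: R]) t = \int[nu]_(t in (~` [set 0] : set (measurableTypeR R))) t.
  by rewrite [RHS]Rintegral_mkcond D0.
rewrite !E /Rintegral; congr fine; apply: eq_measure_integral => A mA AD.
have AE nu : nu A = mrestr nu mD A by rewrite /mrestr setIidl.
rewrite (AE nu1) (AE nu2); apply: finite_measure_eq => //.
  apply: (@le_lt_trans _ _ (nu1 setT)) => //.
  by apply: le_measure; rewrite ?inE//; exact: measurableI.
move=> W oW; change (nu1 (W `&` ~` [set 0]) = nu2 (W `&` ~` [set 0])).
have oWD : open (W `&` ~` [set (0:R)]) by apply: openI => //; apply: closed_openC; exact: closed_eq.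
have nW0 : ~ (W `&` ~` [set (0:R)]) 0 by move=> [_] /=.
by rewrite r1// r2.
Qed.

(** The image of [G] can accumulate outside itself only at 0: near [t != 0] only points with
    [|h| >= |t| / 2] matter, and those in [G] form a compact set. *)
Lemma closed_image_C_0 h (G : set X) : h \in @C_0_pred R X -> closed G ->
  closed (h @` G `|` [set 0]).
Proof.
move=> hC cG t tcl; have [->|t0] := eqVneq t 0; first by right.
left; have ch : continuous h by case/asboolP: hC.
have e0 : 0 < `|t| / 2 by rewrite divr_gt0// normr_gt0.
have cK : compact (G `&` [set x | `|t| / 2 <= `|h x|]).
  rewrite setIC; apply: compact_closedI => //.
  by move/asboolP : hC => [_ /(_ _ e0)].
have cl : closed (h @` (G `&` [set x | `|t| / 2 <= `|h x|])).
  apply: compact_closed; first exact: Rhausdorff.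
  by apply: continuous_compact => //; exact: continuous_subspaceT.
suff : (h @` (G `&` [set x | `|t| / 2 <= `|h x|])) t by move=> [x [Gx _] <-]; exists x.
apply: cl => B Bt.
have : nbhs t (B `&` ball t (`|t| / 2)).
  by apply: filterI => //; exact: nbhsx_ballx.
move=> /tcl[s [hs [Bs]]]; rewrite /ball/= => ts.
have sn : `|t| / 2 <= `|s|.
  have := ler_normD (t - s) s; rewrite subrK => h1; have := ltW ts.
  by rewrite {1}(splitr `|t|) in h1; lra.
exists s; split => //; case: hs => [[x Gx hxs]|/= s0]; last first.
  by move: sn; rewrite s0 normr0; lra.
by exists x => //; split => //=; rewrite hxs.
Qed.

Section composition.
Variables (nu : {measure set (measurableTypeR R) -> \bar R}) (h : X -> R).
Hypothesis hC : h \in @C_0_pred R X.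
Hypothesis nuh : represents mu nu h.

Let Z := h @` setT `|` [set 0].

Let cZ : closed Z. Proof. by apply: closed_image_C_0 => //; exact: closedT. Qed.

(** The complement of [Z] is open, misses 0 and has an empty preimage under [h], so [nu] is carried
    by [Z]. *)
Let nuZ A : measurable A -> nu A = nu (A `&` Z).
Proof.
move=> mA; have mZ : measurable (Z : set (measurableTypeR R)) by exact: closed_measurable.
rewrite [LHS](measureDI _ mA mZ) [X in (X + _)%E](_ : _ = 0%E) ?add0e//.
have oZ : open (~` Z) by exact: closed_openC.
have nZ : nu (~` Z) = 0%E.
  rewrite nuh//; last by apply; right.
  rewrite [X in tm_ext mu X](_ : _ = set0) ?tm_ext0//.
  by rewrite -subset0 => x /= nZ; apply: nZ; left; exists x.
apply/eqP; rewrite eq_le measure_ge0 andbT -nZ; apply: le_measure; rewrite ?inE.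
- exact: measurableD.
- exact: measurableC.
- by move=> x [].
Qed.

(** As [phi] is merely measurable, the preimage of [W] by [phi] need not be open. On [Z], which
    carries [nu], it agrees with the open set [W'] built from a closed image under [h], and [nuh]
    applies to [W']. *)
Lemma represents_comp (phi : R -> R) f (p : {measure set (measurableTypeR R) -> \bar R}) :
  measurable_fun (setT : set R) phi -> phi 0 = 0 -> continuous f ->
  (forall x, f x = phi (h x)) -> (forall A, p A = nu (phi @^-1` A)) ->
  represents mu p f.
Proof.
move=> mphi phi0 cf fE pE W oW nW0.
have mW : measurable (phi @^-1` W : set (measurableTypeR R)).
  by rewrite -[X in measurable X]setTI; apply: mphi => //; exact: open_measurable.
pose G := f @^-1` (~` W).
have cG : closed G by apply: preimage_closed => [x _|]; [exact: cf|exact: open_closedC].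
pose W' := ~` (h @` G `|` [set 0]).
have oW' : open W' by apply: closed_openC; exact: closed_image_C_0.
have nW'0 : ~ W' 0 by apply; right.
have hW' x : W' (h x) <-> W (f x).
  split=> [W'h|Wf [[y Gy hyx]|/= hx0]].
  - by apply: contrapT => nW; apply: W'h; left; exists x.
  - by apply: Gy; rewrite fE hyx -fE.
  - by move: Wf; rewrite fE hx0 phi0.
rewrite pE nuZ//.
have -> : phi @^-1` W `&` Z = W' `&` Z.
  apply/seteqP; split=> t [Wt [[x _ hxt]|/= t0]].
  - by split; [rewrite -hxt; apply/hW'; rewrite fE hxt|left; exists x].
  - by move: Wt; rewrite t0 /= phi0.
  - split; last by left; exists x.
    by move: Wt; rewrite -hxt => /hW'; rewrite fE.
  - by move: Wt; rewrite t0.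
rewrite -nuZ//; last exact: open_measurable.
rewrite nuh//; congr tm_ext; apply/seteqP; split => x /=; first by move/hW'.
by move=> ?; apply/hW'.
Qed.

End composition.

(** [phi] is forced on the range of [h] and set to 0 elsewhere. It is measurable because the images
    under [h] of the closed sublevel sets of [f], with 0 added, are closed. *)
Lemma factor_through h f (M : R) : h \in @C_0_pred R X -> continuous f ->
  (forall x, `|f x| <= M) -> (forall x y, h x = h y -> f x = f y) ->
  (forall x, h x = 0 -> f x = 0) ->
  exists phi : R -> R, [/\ measurable_fun setT phi, phi 0 = 0,
    forall x, f x = phi (h x) & forall t, phi t = 0 \/ exists x, phi t = f x].
Proof.
move=> hC cf fM hf f0.
pose phi (t : R) : R := if pselect (exists x, h x = t) is left e then f (projT1 (cid e)) else 0.
have fE x : f x = phi (h x).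
  rewrite /phi; case: pselect => [e|[]]; last by exists x.
  by apply: hf; case: cid.
have phiN t : ~ (exists x, h x = t) -> phi t = 0.
  by rewrite /phi; case: pselect.
have phi0 : phi 0 = 0.
  have [[x hx0]|] := pselect (exists x, h x = 0); last exact: phiN.
  by rewrite -{1}hx0 -fE; exact: f0.
exists phi; split => //; last first.
  move=> t; have [[x <-]|/phiN] := pselect (exists x, h x = t); last by left.
  by right; exists x.
apply: (measurability (@RGenOInfty.G R)); first exact: RGenOInfty.measurableE.
move=> _ [_ [a ->] <-]; rewrite setTI.
pose G := [set x | f x <= a].
have cG : closed G by exact: closed_preim_ge.
have mG : measurable (h @` G `|` [set 0]).
  by apply: closed_measurable; exact: closed_image_C_0.
have mZ : measurable (h @` setT `|` [set 0]).
  by apply: closed_measurable; apply: closed_image_C_0 => //; exact: closedT.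
(* At the added point, [phi 0 = 0] exceeds [a] exactly when [a < 0], hence two descriptions of the
   superlevel set. *)
have [a0|a0] := leP 0 a.
  rewrite (_ : _ @^-1` _ = (h @` setT `|` [set 0]) `\` (h @` G `|` [set 0])).
    exact: measurableD.
  apply/seteqP; split=> t /=; rewrite in_itv/= andbT.
    have [[x <-]|/phiN ->] := pselect (exists x, h x = t); last by rewrite ltNge a0.
    rewrite -fE => afx; split; first by left; exists x.
    move=> [[y Gy hyx]|hx0]; first by move: afx; rewrite (hf x y)// ltNge Gy.
    by move: afx; rewrite f0// ltNge a0.
  move=> [[[x _ <-]|->] nG]; last by exfalso; apply: nG; right.
  by rewrite -fE ltNge; apply/negP => fxa; apply: nG; left; exists x.
rewrite (_ : _ @^-1` _ = ~` ((h @` G `|` [set 0]) `\` [set 0])).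
  by apply: measurableC; apply: measurableD => //; exact: measurable_set1.
apply/seteqP; split=> t /=; rewrite in_itv/= andbT.
  move=> at_ [[[x Gx hxt]|//] _]; move: at_; rewrite -hxt -fE ltNge.
  by rewrite /G/= in Gx; rewrite Gx.
have [[x <-]|/phiN ->//] := pselect (exists x, h x = t).
rewrite -fE => nG; rewrite ltNge; apply/negP => fxa; apply: nG.
split; first by left; exists x.
by move=> /f0 fx0; move: fxa; rewrite fx0 leNgt a0.
Qed.

End integral_representation.

(** * The functional of a topological measure *)

Section represented_functionals.
Context {R : realType} {X : topologicalType}.
Hypothesis hX : hausdorff_space X.
Variable mu : open_or_closed X -> \bar R.
Hypothesis tm : topological_measure mu.
Variable P : {pred X -> R}.
Hypothesis sP : solid_space P.
Variable r : (X -> R) -> R.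
Implicit Types (nu : {measure set (measurableTypeR R) -> \bar R}) (h f g : X -> R).

(** All that is retained of the Stieltjes construction, so that cases (A) and (B) become instances
    of one argument. Finiteness of [nu] makes bounded measurable functions integrable. *)
Definition represented := forall f, f \in P ->
  exists nu, [/\ (nu setT < +oo)%E, represents mu nu f &
                 r f = \int[nu]_(t in [set: R]) t].

Hypothesis rr : represented.

Lemma represented_comp nu h f (phi : R -> R) (M : R) : h \in P -> f \in P ->
  (nu setT < +oo)%E -> represents mu nu h -> measurable_fun setT phi ->
  (forall t, `|phi t| <= M) -> phi 0 = 0 -> (forall x, f x = phi (h x)) ->
  r f = \int[nu]_(t in [set: R]) phi t.
Proof.
move=> hP fP nuoo nuh mphi phiM phi0 fE; have [nuf [nufoo nuff ->]] := rr f fP.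
have [p [pE <-]] := pushforward_id nu phi M nuoo mphi phiM.
apply: (represents_integral_eq mu nuf p f) => //.
apply: (represents_comp mu tm nu h _ nuh phi) => //.
  exact: (solid_C_0 _ sP).
exact: (solid_cont _ sP).
Qed.

Lemma represented_factor h f : h \in P -> f \in P ->
  (forall x y, h x = h y -> f x = f y) -> (forall x, h x = 0 -> f x = 0) ->
  exists (phi : R -> R) (M : R), [/\ measurable_fun setT phi, phi 0 = 0,
    forall x, f x = phi (h x), forall t, phi t = 0 \/ exists x, phi t = f x &
    forall t, `|phi t| <= M].
Proof.
move=> hP fP hf f0; have [M fM] := C_0_bounded _ (solid_C_0 _ sP _ fP).
have [phi [m0 z0 fE im]] := factor_through h f M
  (solid_C_0 _ sP _ hP) (solid_cont _ sP _ fP) fM hf f0.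
exists phi, `|M|; split => // t; case: (im t) => [->|[x ->]]; first by rewrite normr0.
by apply: le_trans (fM x) _; exact: ler_norm.
Qed.

Lemma represented_add h f g : h \in P -> f \in P -> g \in P ->
  (forall x y, h x = h y -> f x = f y) -> (forall x, h x = 0 -> f x = 0) ->
  (forall x y, h x = h y -> g x = g y) -> (forall x, h x = 0 -> g x = 0) ->
  r (fun x => f x + g x) = r f + r g.
Proof.
move=> hP fP gP hf f0 hg g0.
have [nu [nuoo nuh _]] := rr h hP.
have [phi [M [mphi phi0 fE _ phiM]]] := represented_factor h f hP fP hf f0.
have [psi [N [mpsi psi0 gE _ psiN]]] := represented_factor h g hP gP hg g0.
rewrite (represented_comp nu h f phi M)// (represented_comp nu h g psi N)//.
rewrite (represented_comp nu h _ (fun t => phi t + psi t) (M + N))//.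
- rewrite RintegralD//; first exact: (bounded_integrable nu phi M).
  exact: (bounded_integrable nu psi N).
- exact: solid_add.
- exact: measurable_funD.
- by move=> t; rewrite (le_trans (ler_normD _ _))// lerD.
- by rewrite phi0 psi0 addr0.
- by move=> x; rewrite fE gE.
Qed.

Lemma represented_scale (a : R) f : f \in P -> r (fun x => a * f x) = a * r f.
Proof.
move=> fP; have [nu [nuoo nuf _]] := rr f fP.
have [phi [M [mphi phi0 fE _ phiM]]] := represented_factor f f fP fP
  (fun _ _ => id) (fun _ => id).
rewrite (represented_comp nu f f phi M)//.
rewrite (represented_comp nu f _ (fun t => a * phi t) (`|a| * M))//.
- by rewrite RintegralZl//; exact: (bounded_integrable nu phi M).
- exact: solid_scale.
- exact: measurable_funM.
- by move=> t; rewrite normrM ler_wpM2l.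
- by rewrite phi0 mulr0.
- by move=> x; rewrite -fE.
Qed.

Lemma represented_ge0 f : f \in P -> (forall x, 0 <= f x) -> 0 <= r f.
Proof.
move=> fP f0; have [nu [nuoo nuf _]] := rr f fP.
have [phi [M [mphi phi0 fE im phiM]]] := represented_factor f f fP fP
  (fun _ _ => id) (fun _ => id).
rewrite (represented_comp nu f f phi M)//; apply: Rintegral_ge0 => t _.
by case: (im t) => [->|[x ->]].
Qed.

(* If [X] is compact, members of [S(h)] need not vanish where [h] does, but [h]
   may be replaced by [h + c], which has no zero when [c] is large. *)
Lemma represented_qlf : qlf P r.
Proof.
split; [exact: represented_scale| |exact: represented_ge0].
move=> h f g hP fP gP hf hg.
have Ch : C_b h by exact/C_0_C_b/(solid_C_0 _ sP).
have [ff fz] := generated_fibres _ _ Ch hf.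
have [gf gz] := generated_fibres _ _ Ch hg.
have [cX|ncX] := pselect (compact [set: X]); last first.
  by apply: (represented_add h) => //; [exact: fz|exact: gz].
have /C_bP[ch [M hM]] := Ch.
pose h' x := h x + (`|M| + 1).
have h'P : h' \in P.
  apply: (solid_C_c _ sP); apply/asboolP; split.
    by apply: continuous_addf => //; exact: continuous_cstf.
  by apply: (subclosed_compact _ cX) => //; exact: closed_supp.
have h'0 x : h' x != 0.
  rewrite /h' gt_eqF//; have := hM x; have := ler_norm M.
  by rewrite ler_norml => ? /andP[? ?]; lra.
apply: (represented_add h') => //.
- by move=> x y /addIr /ff.
- by move=> x /eqP; rewrite (negbTE (h'0 x)).
- by move=> x y /addIr /gf.
- by move=> x /eqP; rewrite (negbTE (h'0 x)).
Qed.

(** [clamp 1] fixes functions with values in [0, 1] and lies below the indicator of the open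
    half-line from 0; [clamp 2] reaches 1 at 1/2 and lies above the indicator of the open half-line
    from 1/2. *)
Definition clamp (k t : R) : R := Num.max 0 (Num.min 1 (k * t)).

Lemma clamp_bound k t : 0 <= clamp k t <= 1.
Proof. by rewrite /clamp le_max lexx/= ge_max ler01 ge_min lexx. Qed.

Lemma clamp_norm k t : `|clamp k t| <= 1.
Proof. by have /andP[? ?] := clamp_bound k t; rewrite ger0_norm. Qed.

Lemma continuous_clamp k : continuous (clamp k).
Proof.
apply: continuous_maxf; first exact: continuous_cstf.
apply: continuous_minf; first exact: continuous_cstf.
by apply: continuous_mulf; [exact: continuous_cstf|move=> t; exact: cvg_id].
Qed.

Lemma measurable_clamp k : measurable_fun setT (clamp k).
Proof. by apply: continuous_measurable_fun; exact: continuous_clamp. Qed.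

Lemma clamp0 k : clamp k 0 = 0.
Proof. by rewrite /clamp mulr0 min_r ?maxxx. Qed.

Lemma clampP k f : 0 <= k -> f \in P -> (forall x, 0 <= f x) ->
  (fun x => clamp k (f x)) \in P.
Proof.
move=> k0 fP f0; apply: (solid_le _ sP _ _ (solid_scale _ sP k _ fP)).
  move=> x; apply: (@continuous_comp _ _ _ f (clamp k)).
    exact: (solid_cont _ sP).
  exact: continuous_clamp.
have kf x : 0 <= k * f x by rewrite mulr_ge0.
move=> x; have /andP[? ?] := clamp_bound k (f x).
by rewrite !ger0_norm// /clamp ge_max kf ge_min lexx orbT.
Qed.

Lemma represented_clamp k f : 0 <= k -> f \in P -> (forall x, 0 <= f x) ->
  exists nu, [/\ (nu setT < +oo)%E, represents mu nu f &
    ((r (fun x => clamp k (f x)))%:E = \int[nu]_(t in [set: R]) (clamp k t)%:E)%E].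
Proof.
move=> k0 fP f0; have [nu [nuoo nuf _]] := rr f fP.
exists nu; split => //.
rewrite (represented_comp nu f _ (clamp k) 1)//.
- rewrite /Rintegral fineK//; apply: integrable_fin_num => //.
  apply: (bounded_integrable _ _ 1) => //; [exact: measurable_clamp|].
  by move=> t; exact: clamp_norm.
- exact: clampP.
- exact: measurable_clamp.
- by move=> t; exact: clamp_norm.
- exact: clamp0.
Qed.

Lemma represented_le f (U : set X) : f \in P -> (forall x, 0 <= f x <= 1) ->
  (forall x, 0 < f x -> U x) -> ((r f)%:E <= tm_ext mu U)%E.
Proof.
move=> fP f01 fU.
have f0 x : 0 <= f x by have /andP[] := f01 x.
have [nu [nuoo nuf]] := represented_clamp 1 f ler01 fP f0.
have -> : (fun x => clamp 1 (f x)) = f.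
  apply/funext => x; have /andP[? f1] := f01 x.
  by rewrite /clamp mul1r min_r// max_r.
move=> ->; pose W : set R := [set t | 0 < t].
have oW : open W by exact: open_gt.
apply: (@le_trans _ _ (\int[nu]_(t in setT) (\1_W t)%:E)%E).
  apply: ge0_le_integral => //.
  - by move=> t _; rewrite lee_fin; have /andP[] := clamp_bound 1 t.
  - by apply/measurable_EFinP; exact: measurable_clamp.
  - by apply/measurable_EFinP; apply: measurable_indic; exact: open_measurable.
  - move=> t _; rewrite lee_fin indicE; case: (boolP (t \in W)) => [_|].
      by have /andP[] := clamp_bound 1 t.
    rewrite notin_setE /W => /= /negP; rewrite -leNgt => t0.
    by rewrite /clamp mul1r ge_max lexx ge_min t0 orbT.
rewrite integral_indic//; last exact: open_measurable.
rewrite setIT nuf//; last by rewrite /W/= ltxx.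
exact: tm_extS.
Qed.

(** Representing measures are known on open sets only, so [K] is enlarged to the open set where
    [f > 1/2]; doubling [f] before cutting it at 1 brings the value there up to 1. *)
Lemma represented_ge f (K : set X) : f \in P -> (forall x, 0 <= f x) ->
  (forall x, K x -> f x = 1) ->
  (tm_ext mu K <= (r (fun x => clamp 2 (f x)))%:E)%E.
Proof.
move=> fP f0 fK.
have [nu [nuoo nuf ->]] := represented_clamp 2 f (ler0n R 2) fP f0.
pose W : set R := [set t | 1 / 2 < t].
have oW : open W by exact: open_gt.
apply: (@le_trans _ _ (\int[nu]_(t in setT) (\1_W t)%:E)%E); last first.
  apply: ge0_le_integral => //.
  - by apply/measurable_EFinP; apply: measurable_indic; exact: open_measurable.
  - by apply/measurable_EFinP; exact: measurable_clamp.
  - move=> t _; rewrite lee_fin indicE; case: (boolP (t \in W)) => [|_].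
      rewrite inE /W/= => t2; rewrite /clamp le_max; apply/orP; right.
      by rewrite le_min lexx/=; lra.
    by have /andP[] := clamp_bound 2 t.
rewrite integral_indic//; last exact: open_measurable.
rewrite setIT nuf//; last by rewrite /W/=; lra.
by apply: tm_extS => x Kx; rewrite /W/= fK//; lra.
Qed.

Hypothesis lcX : locally_compact [set: X].

Lemma represented_inner_mass (U : set X) : open U ->
  inner_mass r U = tm_ext mu U.
Proof.
move=> oU; apply/eqP; rewrite eq_le; apply/andP; split.
  apply: ge_ereal_sup => _ [f bf <-]; have [fC f01 fU] := bf.
  apply: represented_le => //; first exact: (solid_C_c _ sP).
  by move=> x fx; apply: fU; apply: supp_neq0; rewrite gt_eqF.
rewrite (tm_ext_sup hX)//; apply: ge_ereal_sup => _ [K [cK KU] <-].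
have [f [fC fU f01 [V [_ KV fV]]]] := urysohn_lc (R := R) hX lcX _ _ cK oU KU.
have fP : f \in P by exact: (solid_C_c _ sP).
have f0 x : 0 <= f x by have /andP[] := f01 x.
apply: le_trans (represented_ge f K fP f0 _) _; first by move=> x /KV/fV.
apply: subord_inner; split.
- apply: (solid_le _ C_c_solid _ _ (solid_scale _ C_c_solid 2 _ fC)).
    by apply: (solid_cont _ sP); exact: clampP.
  move=> x; have /andP[? ?] := clamp_bound 2 (f x).
  have kf y : 0 <= 2 * f y by rewrite mulr_ge0.
  by rewrite !ger0_norm// /clamp ge_max kf ge_min lexx orbT.
- by move=> x; exact: clamp_bound.
- apply: subset_trans fU; apply: supp_sub; first exact: closed_supp.
  by move=> x; apply: contraNP => /supp_eq0 ->; rewrite clamp0.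
Qed.

Lemma represented_outer_mass (A : open_or_closed X) :
  outer_mass r A = mu A.
Proof.
rewrite -(tm_extE mu tm) (tm_ext_inf mu tm) outer_mass_inf.
congr ereal_inf; apply/seteqP; split => _ [U [oU AU] <-]; exists U => //;
  by rewrite outer_massE// represented_inner_mass.
Qed.

End represented_functionals.

(** * The two constructions are inverse to each other *)

Section correspondence.
Context {R : realType} {X : topologicalType}.
Hypothesis hX : hausdorff_space X.
Hypothesis lcX : locally_compact [set: X].
Implicit Types mu nu : open_or_closed X -> \bar R.

Lemma finite_compact_finite mu : topological_measure mu -> finite_tm mu ->
  compact_finite_tm mu.
Proof.
move=> tm muoo K cK; apply: le_lt_trans muoo.
by apply: tm_compact_le_open => //; exact: openT.
Qed.

Lemma represented_rho_c mu : topological_measure mu -> compact_finite_tm mu ->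
  represented mu C_c_pred (extend (rho_c mu : C_c R X -> R)).
Proof.
move=> tm muoo f fC; pose F : C_c R X := insubd (0 : C_c R X) f.
have FE : \val F = f by rewrite /F insubdK.
(* Case (B) counts only points where [f != 0]; they lie in the compact [supp f], which is where
   compact-finiteness is used. *)
pose E := [set x | f x != 0].
have cf : continuous f by case/asboolP: fC.
have fC0 : f \in @C_0_pred R X by exact: C_c_sub_C_0.
have oE : open E.
  rewrite (_ : E = ~` [set x | f x = 0]).
    by apply: closed_openC; apply: (@preimage_closed _ _ f [set 0]) => //; exact: closed_eq.
  by apply/seteqP; split=> x; rewrite /E/=; move/eqP.
have Eoo : (tm_ext mu E < +oo)%E.
  apply: (@le_lt_trans _ _ (tm_ext mu (supp f))).
    by apply: tm_extS => x; exact: supp_neq0.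
  rewrite -[supp f]/(oc_closed _ (closed_supp f) : set X) (tm_extE mu tm).
  by apply: muoo; case/asboolP: fC.
have tailE a : tail_c mu F a = fine (tm_ext mu ([set x | a < f x] `&` E)).
  rewrite /tail_c -(tm_extE mu tm); congr (fine (tm_ext mu _)).
  rewrite /= FE; apply/seteqP; split=> x /=; rewrite in_itv/= andbT /E/=.
    by move=> [-> /eqP].
  by move=> [-> /eqP].
have nuE s t : s < t -> stieltjes (tail_c mu F) `]s, t]%classic =
    (fine (tm_ext mu ([set x | s < f x] `&` E)) -
     fine (tm_ext mu ([set x | t < f x] `&` E)))%:E.
  by move=> st; rewrite stieltjes_tail_c// !tailE.
exists (stieltjes (tail_c mu F)); split => //.
- exact: (tails_finite mu tm f E Eoo).
- exact: (represents_tails hX mu tm f fC0 E).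
Qed.

Lemma represented_rho_0 mu : topological_measure mu -> finite_tm mu ->
  represented mu (@C_0_pred R X) (extend (rho_0 mu : C_0 R X -> R)).
Proof.
move=> tm muoo f fC; pose F : C_0 R X := insubd (0 : C_0 R X) f.
have FE : \val F = f by rewrite /F insubdK.
have Eoo : (tm_ext mu [set: X] < +oo)%E.
  by rewrite -[setT]/(oc_open (@openT X) : set X) (tm_extE mu tm).
have tailE a : tail_0 mu F a = fine (tm_ext mu ([set x | a < f x] `&` setT)).
  rewrite /tail_0 -(tm_extE mu tm) setIT; congr (fine (tm_ext mu _)).
  by rewrite /= FE; apply/seteqP; split=> x /=; rewrite in_itv/= andbT.
have nuE s t : s < t -> stieltjes (tail_0 mu F) `]s, t]%classic =
    (fine (tm_ext mu ([set x | s < f x] `&` setT)) -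
     fine (tm_ext mu ([set x | t < f x] `&` setT)))%:E.
  by move=> st; rewrite stieltjes_tail_0// !tailE.
exists (stieltjes (tail_0 mu F)); split => //.
- exact: (tails_finite mu tm f setT Eoo).
- exact: (represents_tails hX mu tm f fC setT openT).
Qed.

(** The constant is [r u], with [u] equal to 1 around [supp f]. As [e u] is constantly [e] on that
    support, it is stacked over [trunc f e], and the comparison does not presuppose monotonicity. *)
Lemma small_tails_C_c r : qlf (@C_c_pred R X) r -> small_tails C_c_pred r.
Proof.
move=> qr f fC f0; have /asboolP[cf cK] := fC.
have [//|u [uC _ u01 [V [_ KV uV]]]] :=
  urysohn_lc (R := R) hX lcX (supp f) setT cK openT.
exists (r u) => e e0; have e0' := ltW e0; have sC := @C_c_solid R X.
rewrite -(qlf_scale _ _ qr)//; apply: (qlf_stacked_le C_c_pred sC r qr _ _ e) => //.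
- exact: solid_trunc.
- exact: solid_scale.
- move=> x; rewrite trunc_ge0//=.
  have [/KV/uV ->|/supp_eq0 fx] := pselect (supp f x); first by rewrite mulr1 trunc_le.
  rewrite /trunc fx min_l//; have /andP[? _] := u01 x; exact: mulr_ge0.
- by move=> x; have /andP[_ u1] := u01 x; rewrite ler_piMr.
- move=> x; have [/KV/uV ->|/supp_eq0 fx] := pselect (supp f x).
    by right; rewrite mulr1.
  by left; rewrite /trunc fx min_l.
Qed.

Section generic.
Variable P : {pred X -> R}.
Hypothesis sP : solid_space P.
Variable B : subLmodType P.
Implicit Types rho eta : B -> R.

Lemma qnorm_ge rho f : f \in P -> (forall x, 0 <= f x <= 1) ->
  ((extend rho f)%:E <= qnorm rho)%E.
Proof.
move=> fP f01; apply: ereal_sup_ubound.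
by exists (insubd (0 : B) f) => //= x; rewrite insubdK.
Qed.

Lemma inner_mass_qnorm rho (U : set X) : (inner_mass (extend rho) U <= qnorm rho)%E.
Proof.
apply: ge_ereal_sup => _ [f [fC f01 _] <-]; apply: qnorm_ge => //.
exact: (solid_C_c _ sP).
Qed.

(** The constant is the norm: [trunc f e] divided by [e] has values in [0, 1]. *)
Lemma small_tails_qnorm rho : quasi_linear rho -> (qnorm rho < +oo)%E ->
  small_tails P (extend rho).
Proof.
move=> qr qoo f fP f0; have qr' := extend_qlf P sP B rho qr.
exists (fine (qnorm rho)) => e e0; have e0' := ltW e0.
have P0 : (fun=> 0 : R) \in P.
  by apply: (solid_C_c _ sP); exact: (rpred0 (@C_c_pred R X)).
have q0 : (0 <= qnorm rho)%E.
  rewrite -[0%E]/(0%:E) -(qlf0 P sP _ qr'); apply: qnorm_ge => //.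
  by move=> x; rewrite lexx ler01.
have tP : trunc f e \in P by exact: solid_trunc.
rewrite mulrC -ler_pdivrMr// mulrC -(qlf_scale _ _ qr')//.
rewrite -lee_fin fineK ?ge0_fin_numE//; apply: qnorm_ge.
  exact: solid_scale.
move=> x; rewrite mulr_ge0 ?invr_ge0// ?trunc_ge0//=.
by rewrite mulrC ler_pdivrMr// mul1r trunc_le.
Qed.

Lemma mu_of_represented mu rho : topological_measure mu ->
  represented mu P (extend rho) -> mu_of rho = mu.
Proof.
move=> tm rr; apply/funext => A.
by rewrite (mu_of_extend P sP) (represented_outer_mass hX mu tm P sP).
Qed.

Lemma represented_mu_of rho eta :
  quasi_linear rho -> small_tails P (extend rho) ->
  represented (mu_of rho) P (extend eta) -> small_tails P (extend eta) -> eta = rho.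
Proof.
move=> qr tr rr te; have qr' := extend_qlf P sP B rho qr.
have tm := mu_of_topological P sP B hX lcX rho qr tr.
apply/funext => f; rewrite -(extend_val _ B eta) -(extend_val _ B rho).
apply: (qlf_eq P sP) => //; last exact: valP.
  exact: (represented_qlf (mu_of rho) tm P sP).
move=> U oU; rewrite (represented_inner_mass hX (mu_of rho) tm P sP)//.
rewrite -[U in LHS]/(oc_open oU : set X) (tm_extE _ tm) (mu_of_extend P sP).
exact: outer_massE.
Qed.

Lemma represented_monotone mu nu rho eta :
  topological_measure mu -> topological_measure nu ->
  represented mu P (extend rho) -> represented nu P (extend eta) ->
  small_tails P (extend rho) -> small_tails P (extend eta) ->
  le_tm mu nu -> le_functional rho eta.
Proof.
move=> tm tn rm rn tr te mn f f0; rewrite -(extend_val _ B rho) -(extend_val _ B eta).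
apply: (qlf_comparison P sP) => //; last exact: valP.
- exact: (represented_qlf mu tm P sP).
- exact: (represented_qlf nu tn P sP).
- move=> U oU; rewrite (represented_inner_mass hX mu tm P sP)//.
  rewrite (represented_inner_mass hX nu tn P sP)//.
  by rewrite -[U]/(oc_open oU : set X) (tm_extE _ tm) (tm_extE _ tn).
Qed.

(** The supremum defining the norm runs over [P], the one defining the mass over [C_c] only; the
    representation bounds the first by the total mass, which the second already reaches. *)
Lemma represented_qnorm mu rho : topological_measure mu ->
  represented mu P (extend rho) -> qnorm rho = total_mass mu.
Proof.
move=> tm rr; rewrite /total_mass -(tm_extE mu tm) /=.
apply/eqP; rewrite eq_le; apply/andP; split.
  apply: ge_ereal_sup => _ [f f01 <-]; rewrite -(extend_val _ B rho).
  by apply: (represented_le mu tm P sP) => //; exact: valP.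
rewrite -(represented_inner_mass hX mu tm P sP _ rr lcX); last exact: openT.
exact: inner_mass_qnorm.
Qed.

Lemma mu_of_finite rho : (qnorm rho < +oo)%E -> finite_tm (mu_of rho).
Proof.
move=> qoo; apply: le_lt_trans qoo; rewrite /total_mass (mu_of_extend P sP).
by rewrite outer_massE; [exact: inner_mass_qnorm|exact: openT].
Qed.

Lemma quasi_linear_represented mu rho : topological_measure mu ->
  represented mu P (extend rho) -> quasi_linear rho.
Proof.
move=> tm rr; apply: (quasi_linear_extend P).
exact: (represented_qlf mu tm P sP).
Qed.

End generic.

Lemma cancel_set_bij {T U : Type} (A : set T) (B : set U) (f : T -> U) (g : U -> T) :
  (forall x, A x -> B (f x)) -> (forall y, B y -> A (g y)) ->
  {in A, cancel f g} -> {in B, cancel g f} -> set_bij A B f.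
Proof.
move=> fAB gBA fK gK; split.
- by move=> x Ax; exact: fAB.
- move=> x y xA yA fxy; rewrite -(fK x xA) -(fK y yA) fxy//.
- move=> y By; exists (g y); first exact: gBA.
  by apply: gK; rewrite inE.
Qed.

End correspondence.

(** * Linear functionals and measures *)

Section measures.
Context {R : realType} {X : topologicalType}.
Hypothesis hX : hausdorff_space X.
Hypothesis lcX : locally_compact [set: X].

Lemma borel_open (x0 : X) (U : set X) : open U -> measurable (U : set (borel x0)).
Proof. by move=> oU; apply: sub_sigma_algebra. Qed.

Lemma borel_closed (x0 : X) (F : set X) : closed F -> measurable (F : set (borel x0)).
Proof.
move=> cF; rewrite -[F]setCK; apply: measurableC; apply: borel_open.
exact: closed_openC.
Qed.

Lemma continuous_borel (x0 : X) (f : X -> R) : continuous f ->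
  measurable_fun setT (f : borel x0 -> R).
Proof.
move=> cf; apply: (measurability (@RGenOInfty.G R)); first exact: RGenOInfty.measurableE.
move=> _ [_ [a ->] <-]; rewrite setTI; apply: borel_open.
rewrite (_ : _ @^-1` _ = [set x | a < f x]); first exact: open_preim_lt.
by apply/seteqP; split=> x /=; rewrite in_itv/= andbT.
Qed.

(** The functions involved vanish off the compact set [D], so [m] may be replaced by its restriction
    to [D], which is finite. The image of that restriction by [w] represents [w], whence [r w] is
    the integral of [w]. *)
Lemma linear_of_measure (mu : open_or_closed X -> \bar R) :
  topological_measure mu -> compact_finite_tm mu -> is_measure mu ->
  scalar (rho_c mu).
Proof.
move=> tm muoo mm a u v.
have rr := represented_rho_c hX mu tm muoo.
set r := extend (rho_c mu) in rr.
rewrite -!(extend_val _ (C_c R X)) -/r.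
(* The empty space has no base point to build [borel] from; it carries a single function, and both
   sides are 0. *)
have [[x0 _]|nX] := pselect (exists x : X, True); last first.
  have z (f : X -> R) : f = fun=> 0.
    by apply/funext => x; exfalso; apply: nX; exists x.
  rewrite (z (\val (a *: u + v))) (z (\val u)) (z (\val v)).
  rewrite (qlf0 C_c_pred C_c_solid); last exact: (represented_qlf mu tm _ C_c_solid).
  by rewrite mulr0 addr0.
have [m [mE _ _]] := mm x0.
pose D : set X := supp (\val u) `|` supp (\val v).
have cD : closed D by apply: closedU; exact: closed_supp.
have mD : measurable (D : set (borel x0)) by exact: borel_closed.
have cptD : compact D.
  by apply: compactU; [have /asboolP[] := valP u|have /asboolP[] := valP v].
pose md : {measure set (borel x0) -> \bar R} := mrestr m mD.
have mdoo : (md setT < +oo)%E.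
  rewrite /md/= /mrestr setTI -[D]/(oc_closed D cD : set X) -mE.
  exact: muoo.
have rE (w : C_c R X) : (forall x, \val w x != 0 -> D x) ->
    md.-integrable setT (EFin \o (\val w : borel x0 -> R)) /\
    r (\val w) = \int[md]_(x in setT) (\val w x).
  move=> wD; have cw := C_c_continuous w.
  have mw := continuous_borel x0 _ cw.
  have [M wM] := C_0_bounded _ (C_c_sub_C_0 _ (valP w)).
  have [nu [nuoo nuw ->]] := rr _ (valP w).
  have [p [pE pI]] := pushforward_id md _ M mdoo mw wM.
  split; first exact: (bounded_integrable md _ M).
  rewrite -pI; apply: (represents_integral_eq mu nu p (\val w)) => //.
  move=> W oW nW0; rewrite pE /md/= /mrestr.
  have oP : open (\val w @^-1` W) by apply: open_comp => // x _; exact: cw.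
  rewrite setIidl; last first.
    move=> x /= Wx; apply: wD; apply/negP => /eqP wx0; apply: nW0.
    by rewrite -wx0.
  by rewrite -[X in tm_ext mu X]/(oc_open oP : set X) (tm_extE mu tm) mE.
have Dl x : ~ D x -> \val u x = 0 /\ \val v x = 0.
  by move=> /not_orP[nu nv]; split; exact: supp_eq0.
have [|iu ->] := rE u; first by move=> x ux; left; exact: supp_neq0.
have [|iv ->] := rE v; first by move=> x vx; right; exact: supp_neq0.
have uvE x : \val (a *: u + v) x = a * \val u x + \val v x.
  have -> : \val (a *: u + v) = \val (a *: u) + \val v :> (X -> R) by exact: raddfD.
  by have -> : \val (a *: u) = a *: \val u :> (X -> R) by exact: linearZ.
have [|_ ->] := rE (a *: u + v).
  move=> x; rewrite uvE; apply: contraPP => /Dl[-> ->] /eqP; apply.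
  by rewrite mulr0 addr0.
rewrite -RintegralZl// -RintegralD//.
  exact: (integrableZl measurableT a iu).
Qed.

(** * The Borel measure of a linear functional *)

Section riesz.
Variable r : (X -> R) -> R.
Hypothesis qr : qlf (@C_c_pred R X) r.
Hypothesis radd : forall f g, f \in C_c_pred -> g \in C_c_pred ->
  r (fun x => f x + g x) = r f + r g.
Let sC := @C_c_solid R X.
Let tr := small_tails_C_c hX lcX r qr.
Local Open Scope ereal_scope.

Lemma outer_mass0 : outer_mass r set0 = 0.
Proof.
apply/eqP; rewrite eq_le (outer_mass_ge0 C_c_pred)// andbT outer_massE//.
  apply: ge_ereal_sup => _ [f [fC f01 f0] <-]; rewrite (_ : f = fun=> 0%R).
    by rewrite (qlf0 C_c_pred).
  by apply/funext => x; apply: supp_eq0 => /f0.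
exact: open0.
Qed.

(** Full additivity of [r] enters here: the two pieces of [f] may overlap, and nothing places them
    in a common singly generated algebra. *)
Lemma outer_massU_le (U V : set X) : open U -> open V ->
  outer_mass r (U `|` V) <= outer_mass r U + outer_mass r V.
Proof.
move=> oU oV; rewrite [leLHS]outer_massE; last exact: openU.
apply: ge_ereal_sup => _ [f bf <-].
have [f1 [f2 [b1 b2 ->]]] := subord_split hX lcX _ _ _ oU oV bf.
have [C1 _ _] := b1; have [C2 _ _] := b2.
by rewrite radd// EFinD; apply: leeD; exact: subord_outer.
Qed.

Lemma outer_mass_bigsetU_le (U : nat -> set X) n : (forall i, open (U i)) ->
  outer_mass r (\bigcup_(i < n) U i) <= \sum_(0 <= i < n) outer_mass r (U i).
Proof.
move=> oU; elim: n => [|n IH].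
  by rewrite big_geq// bigcup0 ?outer_mass0// => i; rewrite /= ltn0.
rewrite big_nat_recr//= bigcup_mkord big_ord_recr/= -bigcup_mkord.
apply: le_trans (leeD2r _ IH); apply: outer_massU_le => //.
by apply: bigcup_open => i _.
Qed.

Lemma outer_mass_bigcup_le (U : nat -> set X) : (forall i, open (U i)) ->
  outer_mass r (\bigcup_i U i) <= \sum_(0 <= i <oo) outer_mass r (U i).
Proof.
move=> oU; rewrite outer_massE; last by apply: bigcup_open => i _.
apply: ge_ereal_sup => _ [f bf <-]; have [fC f01 fU] := bf.
have cK := subord_compact _ _ bf.
have [n Kn] : exists n, supp f `<=` \bigcup_(i < n) U i.
  have /compact_near_coveringP/(_ nat \oo (fun n x => (\bigcup_(i < n) U i) x)) := cK.
  move=> /(_ _ _)[|n _ /(_ n (leqnn n))]; last by move=> h; exists n.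
  move=> x /fU[i _ Uix].
  exists (U i, [set n | (i < n)%N]) => /=.
    by split; [exact: open_nbhs_nbhs|exists i.+1].
  by move=> [y n] [/= Uiy ni]; exists i.
apply: (@le_trans _ _ (outer_mass r (\bigcup_(i < n) U i))).
  by apply: subord_outer; split.
apply: le_trans (outer_mass_bigsetU_le _ _ oU) _.
by apply: nneseries_lim_ge => // i *; exact: (outer_mass_ge0 C_c_pred).
Qed.

(** When all masses are finite, each [A i] is enlarged to an open set at a cost of
    [e / 2^(i + 1)]. *)
Lemma outer_mass_sigma_subadditive : sigma_subadditive (outer_mass r).
Proof.
move=> A; have g0 i : 0 <= outer_mass r (A i) by exact: (outer_mass_ge0 C_c_pred).
have [[i Aioo]|fin] := pselect (exists i, outer_mass r (A i) = +oo).
  rewrite (_ : \sum_(i <oo) _ = +oo) ?leey//.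
  by apply: (nneseries_pinfty _ _ Aioo).
apply/lee_addgt0Pr => e e0; apply: le_trans (epsilon_trick _ _ (ltW e0)); last first.
  exact: g0.
have Ufin i : exists U, [/\ open U, A i `<=` U &
    outer_mass r U <= outer_mass r (A i) + (e / (2 ^ i.+1)%:R)%:E].
  have [|U [oU AU Ult]] := outer_mass_lt r (A i) (outer_mass r (A i) + (e / (2 ^ i.+1)%:R)%:E).
    rewrite lteDl ?lte_fin ?divr_gt0// ?ltr0n ?expn_gt0//.
    by rewrite ge0_fin_numE// ltey; apply/eqP => Aioo; apply: fin; exists i.
  by exists U; split => //; exact: ltW.
have [U UP] := choice Ufin.
apply: (@le_trans _ _ (outer_mass r (\bigcup_i U i))).
  by apply: outer_massS => x [i _ Aix]; exists i => //; have [_ + _] := UP i; apply.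
apply: le_trans (outer_mass_bigcup_le _ _) _; first by move=> i; have [] := UP i.
apply: lee_nneseries => i *; first exact: (outer_mass_ge0 C_c_pred).
by have [] := UP i.
Qed.

Definition outer_mass_outer_measure : {outer_measure set X -> \bar R} :=
  HB.pack (outer_mass r) (isOuterMeasure.Build R X (outer_mass r)
    outer_mass0 (outer_mass_ge0 _ sC r qr) (outer_massS r)
    outer_mass_sigma_subadditive).

(** [E] is enlarged to an open [V]; the part of [V] outside [U] need be neither open nor closed,
    which superadditivity tolerates. *)
Lemma caratheodory_open (U : set X) : open U ->
  caratheodory_measurable (outer_mass r) U.
Proof.
move=> oU; apply: (@le_caratheodory_measurable _ _ outer_mass_outer_measure) => E /=.
apply: le_ereal_inf_tmp => _ [V [oV EV] <-]; rewrite -outer_massE//.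
apply: (@le_trans _ _ (outer_mass r (V `&` U) + outer_mass r (V `&` ~` U))).
  by apply: leeD; apply: outer_massS; exact: setSI.
apply: (outer_mass_superadd _ sC r qr) => //.
- exact: openI.
- by rewrite -subset0 => x [[_ Ux] [_]]; apply.
Qed.

Lemma caratheodory_borel (x0 : X) (A : set (borel x0)) : measurable A ->
  caratheodory_measurable (outer_mass r) A.
Proof.
pose T := caratheodory_type (outer_mass_outer_measure : set (pointed_at x0) -> \bar R).
move: A; apply: smallest_sub; last by move=> U oU; exact: caratheodory_open.
exact: (@sigma_algebra_measurable _ T).
Qed.

Lemma outer_mass_sigma_additive (x0 : X) :
  semi_sigma_additive (outer_mass r : set (borel x0) -> \bar R).
Proof.
move=> A mA tA mUA.
exact: (@caratheodory_measure_sigma_additive R (pointed_at x0)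
  outer_mass_outer_measure A (fun i => caratheodory_borel x0 _ (mA i)) tA
  (caratheodory_borel x0 _ mUA)).
Qed.

Definition riesz_measure (x0 : X) : {measure set (borel x0) -> \bar R} :=
  HB.pack (outer_mass r : set (borel x0) -> \bar R)
    (isMeasure.Build _ (borel x0) R (outer_mass r) outer_mass0
      (outer_mass_ge0 _ sC r qr) (outer_mass_sigma_additive x0)).

End riesz.

(** The Riesz measure extends [mu] because [outer_mass] recovers [mu] on open and closed sets; its
    regularity is built into [outer_mass]. *)
Lemma measure_of_linear (mu : open_or_closed X -> \bar R) :
  topological_measure mu -> compact_finite_tm mu -> scalar (rho_c mu) ->
  is_measure mu.
Proof.
move=> tm muoo lin x0.
have rr := represented_rho_c hX mu tm muoo.
have sC := @C_c_solid R X.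
have qr := represented_qlf mu tm _ sC _ rr.
have radd f g : f \in C_c_pred -> g \in C_c_pred ->
    extend (rho_c mu) (fun x => f x + g x) =
    extend (rho_c mu) f + extend (rho_c mu) g.
  move=> fC gC; pose F : C_c R X := insubd (0 : C_c R X) f.
  pose G : C_c R X := insubd (0 : C_c R X) g.
  have vD : \val (F + G) = \val F + \val G :> (X -> R) by exact: raddfD.
  have := lin 1 F G; rewrite scale1r mul1r => <-; congr rho_c; apply: val_inj.
  by rewrite vD /F /G !insubdK//; exact: (solid_add _ sC).
exists (riesz_measure _ qr radd x0); split => /=.
- by move=> A; rewrite (represented_outer_mass hX mu tm _ sC _ rr lcX).
- by move=> U oU; rewrite outer_mass_sup.
- by move=> E mE; rewrite outer_mass_inf.
Qed.

End measures.

Theorem theorem42 (R : realType) (X : topologicalType)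
    (hausdorffX : hausdorff_space X)
    (locally_compactX : locally_compact [set: X])
    (connectedX : connected [set: X]) :
  [/\ set_bij (TM_c R X) (QI_c R X) (@rho_c R X),
      {in TM_c R X, cancel (@rho_c R X) (fun rho => mu_of rho)},
      {in QI_c R X, cancel (fun rho => mu_of rho) (@rho_c R X)},
      {in TM_c R X &, forall mu nu,
        le_tm mu nu -> le_functional (rho_c mu) (rho_c nu)} &
      {in TM_c R X, forall mu, is_measure mu <-> scalar (rho_c mu)}] /\
  [/\ set_bij (TM_fin R X) (QI_0_fin R X) (@rho_0 R X),
      {in TM_fin R X, cancel (@rho_0 R X) (fun rho => mu_of rho)},
      {in QI_0_fin R X, cancel (fun rho => mu_of rho) (@rho_0 R X)},
      {in TM_fin R X &, forall mu nu,
        le_tm mu nu -> le_functional (rho_0 mu) (rho_0 nu)} &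
      {in TM_fin R X, forall mu, qnorm (rho_0 mu) = total_mass mu}] /\
  [/\ set_bij (TM_fin R X) (QI_c_fin R X) (@rho_c R X),
      {in TM_fin R X, cancel (@rho_c R X) (fun rho => mu_of rho)},
      {in QI_c_fin R X, cancel (fun rho => mu_of rho) (@rho_c R X)},
      {in TM_fin R X &, forall mu nu,
        le_tm mu nu -> le_functional (rho_c mu) (rho_c nu)} &
      {in TM_fin R X, forall mu, qnorm (rho_c mu) = total_mass mu}].
Proof.
clear connectedX; rename hausdorffX into hX; rename locally_compactX into lcX.
have s0 := @C_0_solid R X; have sc := @C_c_solid R X.
(* Finite topological measures are compact-finite, so the version of (II) on [C_c] is a restriction
   of (I). *)
have TMc mu : TM_fin R X mu -> TM_c R X mu.
  by move=> [tm muoo]; split => //; exact: finite_compact_finite.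
have repc mu : TM_c R X mu -> represented mu C_c_pred (extend (rho_c mu)).
  by move=> [tm muoo]; exact: represented_rho_c.
have rep0 mu : TM_fin R X mu -> represented mu (@C_0_pred R X) (extend (rho_0 mu)).
  by move=> [tm muoo]; exact: represented_rho_0.
have qlc mu : TM_c R X mu -> quasi_linear (rho_c mu).
  by move=> muT; apply: (quasi_linear_represented _ sc _ mu) => //; [case: muT|exact: repc].
have ql0 mu : TM_fin R X mu -> quasi_linear (rho_0 mu).
  by move=> muT; apply: (quasi_linear_represented _ s0 _ mu) => //; [case: muT|exact: rep0].
have normc mu : TM_fin R X mu -> qnorm (rho_c mu) = total_mass mu.
  move=> muT; apply: (represented_qnorm hX lcX _ sc); first by case: muT.
  exact/repc/TMc.
have norm0 mu : TM_fin R X mu -> qnorm (rho_0 mu) = total_mass mu.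
  move=> muT; apply: (represented_qnorm hX lcX _ s0); first by case: muT.
  exact: rep0.
have tailc rho : quasi_linear rho -> small_tails C_c_pred (extend (rho : C_c R X -> R)).
  by move=> qr; apply: small_tails_C_c => //; exact: extend_qlf.
have tail0 rho : QI_0_fin R X rho -> small_tails (@C_0_pred R X) (extend rho).
  by move=> [qr qoo]; exact: (small_tails_qnorm _ s0).
have TMq rho : QI_c R X rho -> TM_c R X (mu_of rho).
  move=> qr; split; first by apply: (mu_of_topological _ sc (C_c R X)) => //; exact: tailc.
  by apply: (mu_of_compact_finite _ sc (C_c R X)) => //; exact: tailc.
have TMf rho : QI_c_fin R X rho -> TM_fin R X (mu_of rho).
  by move=> [/TMq[tm _] qoo]; split => //; exact: (mu_of_finite _ sc).
have TM0 rho : QI_0_fin R X rho -> TM_fin R X (mu_of rho).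
  move=> qr; have [qr' qoo] := qr; split; last exact: (mu_of_finite _ s0).
  by apply: (mu_of_topological _ s0 (C_0 R X)) => //; exact: tail0.
have QI0 mu : TM_fin R X mu -> QI_0_fin R X (rho_0 mu).
  by move=> muT; split; [exact: ql0|rewrite norm0//; case: muT].
have QIf mu : TM_fin R X mu -> QI_c_fin R X (rho_c mu).
  by move=> muT; split; [exact/qlc/TMc|rewrite normc//; case: muT].
have Kc mu : TM_c R X mu -> mu_of (rho_c mu) = mu.
  move=> muT; apply: (mu_of_represented hX lcX _ sc); first by case: muT.
  exact: repc.
have K0 mu : TM_fin R X mu -> mu_of (rho_0 mu) = mu.
  move=> muT; apply: (mu_of_represented hX lcX _ s0); first by case: muT.
  exact: rep0.
have Rc rho : QI_c R X rho -> rho_c (mu_of rho) = rho.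
  move=> qr; have muT := TMq rho qr.
  apply: (represented_mu_of hX lcX _ sc) => //.
  - exact: tailc.
  - exact: repc.
  - by apply: tailc; exact: qlc.
have R0 rho : QI_0_fin R X rho -> rho_0 (mu_of rho) = rho.
  move=> qr; have muT := TM0 rho qr.
  apply: (represented_mu_of hX lcX _ s0) => //.
  - by case: qr.
  - exact: tail0.
  - exact: rep0.
  - by apply: tail0; exact: QI0.
have monoc mu nu : TM_c R X mu -> TM_c R X nu -> le_tm mu nu ->
    le_functional (rho_c mu) (rho_c nu).
  move=> muT nuT; have [tm _] := muT; have [tn _] := nuT.
  by apply: (represented_monotone hX lcX _ sc) => //;
    [exact: repc|exact: repc|apply: tailc; exact: qlc|apply: tailc; exact: qlc].
have mono0 mu nu : TM_fin R X mu -> TM_fin R X nu -> le_tm mu nu ->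
    le_functional (rho_0 mu) (rho_0 nu).
  move=> muT nuT; have [tm _] := muT; have [tn _] := nuT.
  by apply: (represented_monotone hX lcX _ s0) => //;
    [exact: rep0|exact: rep0|apply: tail0; exact: QI0|apply: tail0; exact: QI0].
split; last split; split.
- apply: (cancel_set_bij _ _ _ (fun rho => mu_of rho)) => //.
  + by move=> mu; rewrite inE => /Kc.
  + by move=> rho; rewrite inE => /Rc.
- by move=> mu; rewrite inE => /Kc.
- by move=> rho; rewrite inE => /Rc.
- by move=> mu nu; rewrite !inE; exact: monoc.
- move=> mu; rewrite inE => -[tm muoo]; split.
    exact: linear_of_measure.
  exact: measure_of_linear.
- apply: (cancel_set_bij _ _ _ (fun rho => mu_of rho)) => //.
  + by move=> mu; rewrite inE => /K0.
  + by move=> rho; rewrite inE => /R0.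
- by move=> mu; rewrite inE => /K0.
- by move=> rho; rewrite inE => /R0.
- by move=> mu nu; rewrite !inE; exact: mono0.
- by move=> mu; rewrite inE; exact: norm0.
- apply: (cancel_set_bij _ _ _ (fun rho => mu_of rho)) => //.
  + by move=> mu; rewrite inE => /TMc/Kc.
  + by move=> rho; rewrite inE => -[/Rc].
- by move=> mu; rewrite inE => /TMc/Kc.
- by move=> rho; rewrite inE => -[/Rc].
- by move=> mu nu; rewrite !inE => /TMc ? /TMc; exact: monoc.
- by move=> mu; rewrite inE; exact: normc.
Qed.
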